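(* Let $\mathcal{A}$ be a unital $C^*$-algebra, $\mathcal{B}$ a unital $C^*$-algebra, $\Phi:\mathcal{A}\to\mathcal{B}$ a tracial positive linear map, and $\rho\in\mathcal{A}$ self-adjoint. Let $f,g$ be continuous positive real-valued functions on (an interval containing) the spectrum of $\rho$ such that $f(\rho)g(\rho)>0$ and $\Phi(f(\rho)g(\rho))$ is invertible. Then for every $A\in\mathcal{A}$, \begin{align*} \tfrac12\big(\Phi(f(\rho)A^*g(\rho)A)+\Phi(f(\rho)Ag(\rho)A^* )\big) &\ge \Phi\big(f(\rho)^{1/2}g(\rho)^{1/2}A^*f(\rho)^{1/2}g(\rho)^{1/2}A\big)\\ &\ge \Phi(f(\rho)A^*g(\rho))\,\Phi(f(\rho)g(\rho))^{-1}\,\Phi(g(\rho)Af(\rho)). \end{align*} In particular, for every self-adjoint $A\in\mathcal{A}$, \[ \mathrm{I}_{\rho,\Phi}^{f,g}(A)\ \le\ \mathrm{I}_{\rho,\Phi}^{\sqrt{fg},\sqrt{fg}}(A)\ \le\ \mathrm{Var}_{\rho,\Phi}^{fg,1}(A). \]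
   Context: A linear map $\Phi$ is tracial if $\Phi(XY)=\Phi(YX)$ for all $X,Y$ in its domain, and positive if it maps positive elements to positive elements. $Y>0$ means positive and invertible. For functions $F,G$ on the spectrum of $\rho$: $\mathrm{Corr}_{\rho,\Phi}^{F,G}(A,B):=\Phi(F(\rho)G(\rho)A^*B)-\Phi(F(\rho)A^*G(\rho)B)$, $\mathrm{I}_{\rho,\Phi}^{F,G}(A):=\mathrm{Corr}_{\rho,\Phi}^{F,G}(A,A)$; for $F$ positive and $\Phi(F(\rho)G(\rho)^2)>0$: $\mathrm{Cov}_{\rho,\Phi}^{F,G}(A,B):=\Phi(F(\rho)A^*B)-\Phi(F(\rho)G(\rho)A^* )\Phi(F(\rho)G(\rho)^2)^{-1}\Phi(F(\rho)G(\rho)B)$ and $\mathrm{Var}_{\rho,\Phi}^{F,G}(A):=\mathrm{Cov}_{\rho,\Phi}^{F,G}(A,A)$. Here $fg$ and $\sqrt{fg}$ denote pointwise product and pointwise square root, and $1$ the constant function. *)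

(* Defs.v *)
From Stdlib Require Import Reals Lra List Classical ClassicalEpsilon.
Open Scope R_scope.
Set Implicit Arguments.

Record Cplx := mkC { re : R; im : R }.
Definition Cadd (z w : Cplx) := mkC (re z + re w) (im z + im w).
Definition Cmul (z w : Cplx) :=
  mkC (re z * re w - im z * im w) (re z * im w + im z * re w).
Definition Cconj (z : Cplx) := mkC (re z) (- im z).
Definition Cabs (z : Cplx) := sqrt (re z * re z + im z * im z).
Definition RtoC (x : R) := mkC x 0.
Definition C1 := RtoC 1.

Record CStarAlg := {
  car :> Type;
  zero : car; one : car;
  add : car -> car -> car; opp : car -> car; mul : car -> car -> car;
  smul : Cplx -> car -> car; star : car -> car; norm : car -> R;
  addA : forall x y z, add x (add y z) = add (add x y) z;
  addC : forall x y, add x y = add y x;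
  add0 : forall x, add zero x = x;
  addN : forall x, add x (opp x) = zero;
  smulA : forall c d x, smul c (smul d x) = smul (Cmul c d) x;
  smul1 : forall x, smul C1 x = x;
  smulDl : forall c d x, smul (Cadd c d) x = add (smul c x) (smul d x);
  smulDr : forall c x y, smul c (add x y) = add (smul c x) (smul c y);
  mulA : forall x y z, mul x (mul y z) = mul (mul x y) z;
  mul1l : forall x, mul one x = x;
  mul1r : forall x, mul x one = x;
  mulDl : forall x y z, mul (add x y) z = add (mul x z) (mul y z);
  mulDr : forall x y z, mul x (add y z) = add (mul x y) (mul x z);
  smulMl : forall c x y, smul c (mul x y) = mul (smul c x) y;
  smulMr : forall c x y, smul c (mul x y) = mul x (smul c y);
  starK : forall x, star (star x) = x;
  starD : forall x y, star (add x y) = add (star x) (star y);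
  starM : forall x y, star (mul x y) = mul (star y) (star x);
  starZ : forall c x, star (smul c x) = smul (Cconj c) (star x);
  norm_ge0 : forall x, 0 <= norm x;
  norm_eq0 : forall x, norm x = 0 -> x = zero;
  norm_triangle : forall x y, norm (add x y) <= norm x + norm y;
  normZ : forall c x, norm (smul c x) = Cabs c * norm x;
  norm_subm : forall x y, norm (mul x y) <= norm x * norm y;
  norm_cstar : forall x, norm (mul (star x) x) = norm x * norm x;
  complete : forall u : nat -> car,
    (forall eps, 0 < eps -> exists N, forall m n, (N <= m)%nat -> (N <= n)%nat ->
        norm (add (u m) (opp (u n))) < eps) ->
    exists l, forall eps, 0 < eps -> exists N, forall n, (N <= n)%nat ->
        norm (add (u n) (opp l)) < eps
}.

Section Ops.
Context {A : CStarAlg}.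
Definition sub (x y : A) : A := add A x (opp A y).
Definition rsc (r : R) (x : A) : A := smul A (RtoC r) x.
Definition self_adjoint (x : A) := star A x = x.
Definition invertible (x : A) := exists y : A, mul A x y = one A /\ mul A y x = one A.
Definition spec (x : A) (z : Cplx) := ~ invertible (sub x (smul A z (one A))).
Definition specR (x : A) (t : R) := spec x (RtoC t).
Definition positive (x : A) :=
  self_adjoint x /\ forall z, spec x z -> im z = 0 /\ 0 <= re z.
Definition strictly_positive (x : A) := positive x /\ invertible x.
Definition le (x y : A) := positive (sub y x).
Definition inv (x : A) : A :=
  epsilon (inhabits (zero A)) (fun y => mul A x y = one A /\ mul A y x = one A).
Fixpoint peval (p : list R) (x : A) : A :=
  match p with
  | nil => zero A
  | c :: q => add A (rsc c (one A)) (mul A x (peval q x))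
  end.
(* continuous functional calculus: y = f(x) means y is the norm-limit of
   p(x) for polynomials p converging uniformly to f on the spectrum of x. *)
Definition is_fcalc (x : A) (f : R -> R) (y : A) :=
  forall eps, 0 < eps -> exists p : list R,
    (forall t, specR x t -> Rabs (f t - fold_right (fun c acc => c + t * acc) 0 p) <= eps) /\
    norm A (sub y (peval p x)) <= eps.
Definition fcalc (x : A) (f : R -> R) : A :=
  epsilon (inhabits (zero A)) (is_fcalc x f).
End Ops.

Definition linear_map {A B : CStarAlg} (Phi : A -> B) :=
  (forall x y, Phi (add A x y) = add B (Phi x) (Phi y)) /\
  (forall c x, Phi (smul A c x) = smul B c (Phi x)).
Definition positive_map {A B : CStarAlg} (Phi : A -> B) :=
  forall x : A, positive x -> positive (Phi x).
Definition tracial {A B : CStarAlg} (Phi : A -> B) :=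
  forall x y : A, Phi (mul A x y) = Phi (mul A y x).

Definition cont_on (S : R -> Prop) (f : R -> R) :=
  forall t, S t -> forall eps, 0 < eps -> exists delta, 0 < delta /\
    forall s, S s -> Rabs (s - t) < delta -> Rabs (f s - f t) < eps.

Definition Corr {A B : CStarAlg} (rho : A) (Phi : A -> B) (F G : R -> R) (X Y : A) : B :=
  let Fr := fcalc rho F in let Gr := fcalc rho G in
  sub (Phi (mul A (mul A Fr Gr) (mul A (star A X) Y)))
      (Phi (mul A (mul A Fr (star A X)) (mul A Gr Y))).
Definition Iinfo {A B : CStarAlg} (rho : A) (Phi : A -> B) (F G : R -> R) (X : A) : B :=
  Corr rho Phi F G X X.
Definition Cov {A B : CStarAlg} (rho : A) (Phi : A -> B) (F G : R -> R) (X Y : A) : B :=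
  let Fr := fcalc rho F in let Gr := fcalc rho G in
  sub (Phi (mul A Fr (mul A (star A X) Y)))
      (mul B (mul B (Phi (mul A (mul A Fr Gr) (star A X)))
                    (inv (Phi (mul A Fr (mul A Gr Gr)))))
             (Phi (mul A (mul A Fr Gr) Y))).
Definition Var {A B : CStarAlg} (rho : A) (Phi : A -> B) (F G : R -> R) (X : A) : B :=
  Cov rho Phi F G X X.

(* Main.v *)
(* For a tracial map [Phi], left multiplication by [h] and right multiplication by [k]
   commute, so for self-adjoint [h], [k] and [e] the pairing (p, q) |-> Phi (p(h) e q(k) e)
   is a positive bimeasure on the product of the two spectra, in which h e + i e k plays
   the role of the coordinate function z = s + i t.  Integrating
   (z - b)^* (z - b) >= 0 (through Bernstein partitions of unity) gives a Cauchy-Schwarz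
   inequality for Phi at h e + i e k, with an arbitrary b in B.  For positive invertible e
   every X can be written as h e + i e k, by solving the Sylvester equation
   h e^2 + e^2 h = X e + e X^*.  With e = (f g)^(1/2)(rho), applied to e^(1/2) A e^(1/2) and
   b = Phi(e^2)^(-1) Phi(e^2 A), this is the second inequality; the first one is
   Phi((Y - Z)^* (Y - Z)) >= 0 for Y = g^(1/2) A f^(1/2), Z = f^(1/2) A g^(1/2).

   As [positive] is defined by the spectrum, the positive cone needs the spectral radius
   formula for self-adjoint elements (Rickart's averaging argument), the spectral mapping
   theorem for polynomials, the continuous functional calculus, and Kaplansky's theorem
   that [x^* x] is positive. *)
From Stdlib Require Ncring Ncring_tac.
From mathcomp Require ssrfun ssrbool eqtype ssrnat seq choice bigop ssralg poly closed_field complex Rstruct.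
From Stdlib Require Import Reals Lra Lia List Classical ClassicalEpsilon ssreflect.
Require Import Defs.
Open Scope R_scope.
Set Implicit Arguments.

(** The second inequality is a Schwarz inequality for the [B]-valued form [Phi (x^* * y)], between
    the vectors [X] and [e]. The usual proof expands the square of [X - e b], but [b] lies in [B]
    and not in [A], and positivity of [Phi] is a statement about single elements, which does not by
    itself control the two-by-two matrix of values of the form. Over a commutative algebra this
    difficulty disappears, because a positive map is then integration against an operator-valued
    measure and the square can be expanded pointwise, between [b^*] and [b]. The form brings its own
    commutative algebra: left multiplication by [h] is self-adjoint for it, right multiplication by
    [k] is so by traciality, and [h e + i e k] is the normal operator with these real and imaginary
    parts, applied to [e]. Thus [e] stands for the constant function 1, which explains both its two
    occurrences in the pairing and the one-sided positions of [e] in the decomposition. Conjugating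
    by [e^(1/2)] converts the weighted terms of the theorem into this unweighted form. *)

Module NC.
Import Ncring Ncring_tac.
Section Instances.
Context (A : CStarAlg).
#[global] Instance ops : @Ring_ops (car A) (Defs.zero A) (Defs.one A) (Defs.add A)
  (Defs.mul A) (@Defs.sub A) (Defs.opp A) (@eq A) := {}.
#[global] Instance ring : Ring (Ro := ops).
Proof.
split; try (repeat intro; hnf in *; subst; reflexivity).
- split; red; intros; hnf in *; congruence.
- exact (add0 A).
- exact (addC A).
- exact (addA A).
- exact (mul1l A).
- exact (mul1r A).
- exact (mulA A).
- exact (mulDl A).
- intros; exact (mulDr A _ _ _).
- intros; exact (addN A _).
Qed.
End Instances.
Ltac nc := non_commutative_ring.
End NC.
Ltac nc := NC.nc.

(** * Complex polynomials and their roots *)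

Definition C0 : Cplx := RtoC 0.
Definition Ci : Cplx := mkC 0 1.

Fixpoint ceval (p : list Cplx) (z : Cplx) : Cplx :=
  match p with nil => C0 | c :: q => Cadd c (Cmul z (ceval q z)) end.

Module FTA.
Import ssrfun ssrbool eqtype ssrnat seq choice bigop ssralg poly closed_field complex Rstruct.
Import GRing.Theory.

Definition toC (z : Cplx) : complex R := Complex (re z) (im z).
Definition ofC (z : complex R) : Cplx := mkC (complex.Re z) (complex.Im z).

Lemma toCK z : ofC (toC z) = z. Proof. by case: z. Qed.

Lemma ofCK z : toC (ofC z) = z. Proof. by case: z. Qed.

Lemma ceval_horner (p : list Cplx) z :
  toC (ceval p z) = horner (Poly (map toC p)) (toC z).
Proof.
elim: p => [|c q IH]; first by rewrite /= horner0.
rewrite /= horner_cons -IH.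
case: c z (ceval q z) {IH} => [a b] [u v] [s t]; rewrite /toC /=.
by congr Complex; rewrite /= /GRing.add /GRing.mul /= ?/GRing.opp /=; ring.
Qed.

(** The field of complex numbers is algebraically closed, so only a nonzero constant lacks a root;
    as [q] may end in zeros, constancy reads entrywise. The zero polynomial falls under the second
    alternative. *)
Lemma ceval_root (c : Cplx) (q : list Cplx) :
  (forall z, In z q -> z = C0) \/ exists z, ceval (c :: q) z = C0.
Proof.
case: (eqVneq (seq.size (polyseq (Poly (map toC (c :: q))))) 1%N) => Hs; last first.
  move/closed_rootP: Hs => [x /eqP Hx].
  by right; exists (ofC x); rewrite -[LHS]toCK ceval_horner ofCK Hx.
left => z Hz.
have [i Hi Ei] : exists2 i, (i < seq.size q)%N & z = seq.nth C0 q i.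
  elim: q {Hs} Hz => //= a q IH [->|/IH[i Hi ->]]; first by exists 0%N.
  by exists i.+1.
rewrite Ei -[LHS]toCK -(nth_map C0 (toC C0)) //.
have -> : seq.nth (toC C0) (map toC q) i =
          seq.nth 0%R (polyseq (Poly (map toC (c :: q)))) i.+1.
  by rewrite coef_Poly.
by rewrite nth_default ?Hs.
Qed.
End FTA.

Lemma Cplx_ext (z w : Cplx) : re z = re w -> im z = im w -> z = w.
Proof. by case: z w => [a b] [c d] /= -> ->. Qed.

Ltac cplx := apply: Cplx_ext; cbn; try ring.

(* Algebra, norm estimates and Neumann series *)
Declare Scope alg_scope.
Delimit Scope alg_scope with A.
Bind Scope alg_scope with car.
Notation "x + y" := (add _ x y) : alg_scope.
Notation "x - y" := (sub x y) : alg_scope.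
Notation "- x" := (opp _ x) : alg_scope.
Notation "x * y" := (mul _ x y) : alg_scope.
Notation "0" := (zero _) : alg_scope.
Notation "1" := (one _) : alg_scope.
Notation "c *: x" := (smul _ c x) (at level 40, left associativity) : alg_scope.
Notation "r .* x" := (rsc r x) (at level 40, left associativity) : alg_scope.
Notation "x ^*" := (star _ x) (at level 2, left associativity, format "x ^*") : alg_scope.
Notation nrm := (norm _).

Section Basics.
Context {A : CStarAlg}.
Implicit Types (x y z : A) (c d : Cplx) (r s : R).

Lemma addx0 x : (x + 0)%A = x. Proof. nc. Qed.

Lemma subE x y : (x - y)%A = (x + - y)%A. Proof. by []. Qed.

Lemma sub_eq0 x y : (x - y)%A = 0%A -> x = y.
Proof. move=> H; have -> : x = (x - y + y)%A by nc. rewrite H; nc. Qed.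

Lemma smul0 x : (C0 *: x)%A = 0%A.
Proof.
have H : (C0 *: x + C0 *: x)%A = (C0 *: x)%A.
  by rewrite -smulDl; congr smul; cplx.
have -> : (C0 *: x)%A = ((C0 *: x + C0 *: x) - C0 *: x)%A by nc.
rewrite H; nc.
Qed.

Lemma smulx0 c : (c *: 0)%A = 0%A :> A.
Proof.
have H : (c *: 0 + c *: 0)%A = (c *: 0)%A :> A by rewrite -smulDr; congr smul; nc.
have -> : (c *: 0)%A = ((c *: 0 + c *: 0) - c *: 0)%A :> A by nc.
rewrite H; nc.
Qed.

Lemma rsc1 x : (1 .* x)%A = x. Proof. exact: smul1. Qed.

Lemma rsc0 x : (0 .* x)%A = 0%A. Proof. exact: smul0. Qed.

Lemma rscx0 r : (r .* 0)%A = 0%A :> A. Proof. exact: smulx0. Qed.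

Lemma rscA r s x : (r .* (s .* x))%A = ((r * s) .* x)%A.
Proof. by rewrite /rsc smulA; congr smul; cplx. Qed.

Lemma rscDl r s x : ((r + s) .* x)%A = (r .* x + s .* x)%A.
Proof. by rewrite /rsc -smulDl; congr smul; cplx. Qed.

Lemma rscDr r x y : (r .* (x + y))%A = (r .* x + r .* y)%A.
Proof. exact: smulDr. Qed.

Lemma rscMl r x y : (r .* (x * y))%A = (r .* x * y)%A.
Proof. exact: smulMl. Qed.

Lemma rscMr r x y : (r .* (x * y))%A = (x * (r .* y))%A.
Proof. exact: smulMr. Qed.

Lemma smulN c x : (c *: (- x))%A = (- (c *: x))%A.
Proof.
have H : (c *: (- x) + c *: x)%A = 0%A.
  by rewrite -smulDr (_ : (- x + x)%A = 0%A) ?smulx0 //; nc.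
have -> : (c *: (- x))%A = (c *: (- x) + c *: x - c *: x)%A by nc.
rewrite H; nc.
Qed.

Lemma smulB c x y : (c *: (x - y))%A = (c *: x - c *: y)%A.
Proof. by rewrite subE smulDr smulN. Qed.

Lemma rscN r x : ((- r) .* x)%A = (- (r .* x))%A.
Proof.
have H : ((- r) .* x + r .* x)%A = 0%A.
  by rewrite -rscDl (_ : - r + r = 0) ?rsc0 //; ring.
have -> : ((- r) .* x)%A = ((- r) .* x + r .* x - r .* x)%A by nc.
rewrite H; nc.
Qed.

Lemma oppE x : (- x)%A = (Ropp 1 .* x)%A.
Proof. by rewrite -[in LHS](rsc1 x) -rscN. Qed.

Lemma rscB r x y : (r .* (x - y))%A = (r .* x - r .* y)%A.
Proof. exact: smulB. Qed.

Lemma rsc_inv r x : r <> 0 -> (r .* (/ r .* x))%A = x.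
Proof. by move=> H; rewrite rscA Rinv_r // rsc1. Qed.

Lemma rsc_half x : (/ 2 .* (x + x))%A = x.
Proof. by rewrite rscDr -rscDl (_ : / 2 + / 2 = 1) ?rsc1 //; field. Qed.

Lemma CiCi x : (Ci *: (Ci *: x))%A = (- x)%A.
Proof. by rewrite -[in RHS](rsc1 x) -rscN /rsc smulA; congr smul; cplx. Qed.

Lemma rsc_Ci r x : (r .* (Ci *: x))%A = (Ci *: (r .* x))%A.
Proof. by rewrite /rsc !smulA; congr smul; cplx. Qed.

Lemma star0 : (0^* )%A = 0%A :> A.
Proof. by rewrite -(smul0 0%A) starZ; rewrite (_ : Cconj C0 = C0) ?smul0 //; cplx. Qed.

Lemma starN x : ((- x)^* )%A = (- x^* )%A.
Proof.
have H : ((- x)^* + x^* )%A = 0%A.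
  by rewrite -starD (_ : (- x + x)%A = 0%A) ?star0 //; nc.
have -> : ((- x)^* )%A = ((- x)^* + x^* - x^* )%A by nc.
rewrite H; nc.
Qed.

Lemma starB x y : ((x - y)^* )%A = (x^* - y^* )%A.
Proof. by rewrite subE starD starN. Qed.

Lemma star1 : (1^* )%A = 1%A :> A.
Proof. by rewrite -[LHS]mul1r -{2}(starK _ 1%A) -starM mul1r starK. Qed.

Lemma star_rsc r x : ((r .* x)^* )%A = (r .* x^* )%A.
Proof. by rewrite starZ; congr smul; cplx. Qed.

Lemma star_Ci x : ((Ci *: x)^* )%A = (- (Ci *: x^* ))%A.
Proof. by rewrite starZ [RHS]oppE /rsc smulA; congr smul; cplx. Qed.

Lemma sa0 : self_adjoint (0%A : A). Proof. exact: star0. Qed.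
Lemma sa1 : self_adjoint (1%A : A). Proof. exact: star1. Qed.
Lemma saD x y : self_adjoint x -> self_adjoint y -> self_adjoint (x + y)%A.
Proof. by rewrite /self_adjoint starD => -> ->. Qed.
Lemma saB x y : self_adjoint x -> self_adjoint y -> self_adjoint (x - y)%A.
Proof. by rewrite /self_adjoint starB => -> ->. Qed.
Lemma sa_rsc r x : self_adjoint x -> self_adjoint (r .* x)%A.
Proof. by rewrite /self_adjoint star_rsc => ->. Qed.
Lemma saM x y : self_adjoint x -> self_adjoint y -> (x * y)%A = (y * x)%A ->
  self_adjoint (x * y)%A.
Proof. by rewrite /self_adjoint starM => -> -> ->. Qed.
Lemma sa_starM x : self_adjoint (x^* * x)%A.
Proof. by rewrite /self_adjoint starM starK. Qed.

Lemma Cabs_RtoC r : Cabs (RtoC r) = Rabs r.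
Proof. by rewrite /Cabs /= (_ : r * r + 0 * 0 = Rsqr r) ?sqrt_Rsqr_abs // /Rsqr; ring. Qed.

Lemma norm_rsc r x : nrm (r .* x) = Rabs r * nrm x.
Proof. by rewrite normZ Cabs_RtoC. Qed.

Lemma norm0 : nrm (0 : A) = 0.
Proof. by rewrite -(rsc0 0%A) norm_rsc Rabs_R0 Rmult_0_l. Qed.

Lemma normN x : nrm (- x) = nrm x.
Proof. by rewrite -[in LHS](rsc1 x) -rscN norm_rsc Rabs_Ropp Rabs_R1 Rmult_1_l. Qed.

Lemma norm_subC x y : nrm (x - y) = nrm (y - x).
Proof. by rewrite -normN; congr norm; nc. Qed.

Lemma norm_triangle_sub x y : nrm (x - y) <= nrm x + nrm y.
Proof. by rewrite -(normN y); exact: norm_triangle. Qed.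

Lemma norm_sub_le x y z : nrm (x - z) <= nrm (x - y) + nrm (y - z).
Proof.
have -> : (x - z)%A = ((x - y) + (y - z))%A by nc.
exact: norm_triangle.
Qed.

Lemma norm_le_sub x y : nrm x <= nrm y + nrm (x - y).
Proof.
have {1}-> : x = (y + (x - y))%A by nc.
exact: norm_triangle.
Qed.

Lemma norm_small x : (forall eps, 0 < eps -> nrm x <= eps) -> x = 0%A.
Proof.
move=> H; apply: norm_eq0; apply: Rle_antisym (norm_ge0 _ _).
by apply: le_epsilon => e He; rewrite Rplus_0_l; exact: H.
Qed.

Lemma norm_star_le x : nrm x <= nrm (x^*).
Proof.
have H := norm_subm A x^*%A x; rewrite norm_cstar in H.
have := norm_ge0 A x; have := norm_ge0 A x^*%A.
case: (Rle_lt_or_eq_dec _ _ (norm_ge0 A x)) => [h|<-] *; last by lra.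
by apply: (Rmult_le_reg_r _ _ _ h).
Qed.

Lemma norm_star x : nrm (x^*) = nrm x.
Proof.
apply: Rle_antisym; last exact: norm_star_le.
by rewrite -{2}(starK _ x); exact: norm_star_le.
Qed.

Lemma norm_sa_sqr x : self_adjoint x -> nrm (x * x) = nrm x * nrm x.
Proof. by move=> H; rewrite -norm_cstar H. Qed.

(** Only an inequality, since the record admits the zero algebra, where this norm is 0. *)
Lemma norm1_le1 : nrm (1 : A) <= 1.
Proof.
have := norm_sa_sqr sa1; rewrite mul1l; have := norm_ge0 A 1%A; nra.
Qed.

Definition is_inv x y := (x * y)%A = 1%A /\ (y * x)%A = 1%A.

Lemma is_inv_unique x y z : is_inv x y -> is_inv x z -> y = z.
Proof. by case=> [_ H1] [H2 _]; rewrite -(mul1r _ y) -H2 mulA H1 mul1l. Qed.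

Lemma is_inv_mul x y x' y' : is_inv x x' -> is_inv y y' ->
  is_inv (x * y)%A (y' * x')%A.
Proof.
case=> [H1 H2] [H3 H4]; split.
- have -> : (x * y * (y' * x'))%A = (x * (y * y') * x')%A by nc.
  by rewrite H3 mul1r.
- have -> : (y' * x' * (x * y))%A = (y' * (x' * x) * y)%A by nc.
  by rewrite H2 mul1r.
Qed.

Lemma is_inv_star x y : is_inv x y -> is_inv x^*%A y^*%A.
Proof. by case=> [H1 H2]; split; rewrite -starM ?H1 ?H2 star1. Qed.

Lemma inv_sa x y : self_adjoint x -> is_inv x y -> self_adjoint y.
Proof. by move=> Hx H; have H' := is_inv_star H; rewrite Hx in H'; exact: is_inv_unique H' H. Qed.

Lemma invP x : invertible x -> is_inv x (inv x).
Proof. by move=> H; exact: epsilon_spec. Qed.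

Lemma invertible_smul c x : c <> C0 -> invertible x -> invertible (c *: x)%A.
Proof.
move=> Hc [y [H1 H2]].
have [d Hd] : exists d, Cmul c d = C1.
  case: c Hc => [a b] H.
  have P : 0 < a * a + b * b.
    case: (Req_dec a 0) => [Ea|]; last by nra.
    case: (Req_dec b 0) => [Eb|]; last by nra.
    by case: H; rewrite Ea Eb.
  by exists (mkC (a / (a * a + b * b)) (- b / (a * a + b * b))); cplx; field; lra.
have Hd' : Cmul d c = C1 by rewrite -Hd; cplx.
by exists (d *: y)%A; split; rewrite -smulMl -smulMr smulA ?Hd ?Hd' smul1.
Qed.

(** If [z] inverts [x y], then [z y] is a left inverse of [x] by commutation and [y z] a right
    inverse, so the two agree. *)
Lemma invertible_factor x y : (x * y)%A = (y * x)%A -> invertible (x * y)%A ->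
  invertible x.
Proof.
move=> C [z [H1 H2]]; exists (y * z)%A.
have H3 : (z * y * x)%A = 1%A by rewrite -mulA -C.
have H4 : (x * (y * z))%A = 1%A by rewrite mulA.
split=> //.
rewrite -[LHS]mul1l -{1}H3.
have -> : (z * y * x * (y * z * x))%A = (z * y * (x * (y * z)) * x)%A by nc.
by rewrite H4 mul1r.
Qed.

(** Banach's fixed point theorem. It takes the place of infinite series, both for [Neumann] and for
    [sylvester]. *)
Lemma contraction (T : A -> A) q : 0 <= q < 1 ->
  (forall x y, nrm (T x - T y) <= q * nrm (x - y)) -> exists x, T x = x.
Proof.
move=> Hq HT.
pose u n := Nat.iter n T 0%A.
(* The geometric series that bounds the distance of the whole orbit from its start: the solution of
   [D = q * D + nrm (u 1 - u 0)]. *)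
pose D := nrm (u 1%nat - u 0%nat) / (1 - q).
have D0 : 0 <= D.
  by apply: Rmult_le_pos; [exact: norm_ge0 | apply: Rlt_le; apply: Rinv_0_lt_compat; lra].
have HD : q * D + nrm (u 1%nat - u 0%nat) = D by rewrite /D; field; lra.
have B0 k : nrm (u k - u 0%nat) <= D.
  elim: k => [|k IH]; first by rewrite (_ : (_ - _)%A = 0%A) ?norm0 //; nc.
  have := norm_sub_le (u (S k)) (u 1%nat) (u 0%nat).
  have : nrm (u (S k) - u 1%nat) <= q * nrm (u k - u 0%nat) := HT _ _.
  have := Rmult_le_compat_l q _ _ (proj1 Hq) IH; lra.
have B n k : nrm (u (n + k)%nat - u n) <= q ^ n * D.
  elim: n => [|n IH]; first by rewrite /= Rmult_1_l; exact: B0.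
  rewrite /= Rmult_assoc.
  apply: Rle_trans (HT _ _) _; apply: Rmult_le_compat_l; [lra | exact: IH].
have Hlim e : 0 < e -> exists N, forall n, (N <= n)%nat -> q ^ n * D < e.
  move=> He; have [N HN] := pow_lt_1_zero q ltac:(rewrite Rabs_right; lra) (e / (D + 1))
    ltac:(apply: Rdiv_lt_0_compat; lra).
  exists N => n Hn; have := HN n Hn; rewrite Rabs_right; last by apply: Rle_ge; apply: pow_le; lra.
  move=> H; have P := pow_le q n (proj1 Hq).
  have : q ^ n * (D + 1) < e.
    have -> : e = e / (D + 1) * (D + 1) by field; lra.
    apply: Rmult_lt_compat_r; lra.
  lra.
have [e He|l Hl] := complete A u.
  have [N HN] := Hlim e He; exists N => m n Hm Hn.
  rewrite -/(u m - u n)%A.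
  case: (Nat.le_ge_cases n m) => Hmn.
  - have -> : m = (n + (m - n))%nat by lia.
    by have := B n (m - n)%nat; have := HN n Hn; lra.
  - have -> : n = (m + (n - m))%nat by lia.
    by rewrite norm_subC; have := B m (n - m)%nat; have := HN m Hm; lra.
exists l; apply: sub_eq0; apply: norm_small => e He.
have [N HN] := Hl (e / 2) ltac:(lra).
have H1 := HN N ltac:(lia); have H2 := HN (S N) ltac:(lia).
rewrite -/(u N - l)%A in H1; rewrite -/(u (S N) - l)%A in H2.
have := norm_sub_le (T l) (u (S N)) l.
have : nrm (T l - u (S N)) <= q * nrm (l - u N) := HT _ _.
rewrite (norm_subC l).
have := norm_ge0 A (u N - l)%A; nra.
Qed.

(** The fixed points of [1 + x y] and [1 + z x] are a right and a left inverse of [1 - x], hence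
    equal; the bound is the triangle inequality in [y = 1 + x y]. *)
Lemma Neumann x : nrm x < 1 ->
  exists y, is_inv (1 - x)%A y /\ nrm y * (1 - nrm x) <= 1.
Proof.
move=> Hx; have N0 := norm_ge0 A x.
have [y Hy] : exists y, (1 + x * y)%A = y.
  apply: (@contraction (fun y => 1 + x * y)%A (nrm x)) => // a b.
  have -> : (1 + x * a - (1 + x * b))%A = (x * (a - b))%A by nc.
  exact: norm_subm.
have [z Hz] : exists z, (1 + z * x)%A = z.
  apply: (@contraction (fun z => 1 + z * x)%A (nrm x)) => // a b.
  have -> : (1 + a * x - (1 + b * x))%A = ((a - b) * x)%A by nc.
  by rewrite Rmult_comm; exact: norm_subm.
have H1 : ((1 - x) * y)%A = 1%A.
  have -> : ((1 - x) * y)%A = (y - x * y)%A by nc.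
  rewrite -{1}Hy; nc.
have H2 : (z * (1 - x))%A = 1%A.
  have -> : (z * (1 - x))%A = (z - z * x)%A by nc.
  rewrite -{1}Hz; nc.
have E : z = y by rewrite -(mul1r _ z) -H1 mulA H2 mul1l.
exists y; split; first by split=> //; rewrite -E.
have := norm_triangle A 1%A (x * y)%A; rewrite Hy.
have := norm_subm A x y; have := norm1_le1; lra.
Qed.

Lemma perturb x y (d : A) : is_inv x y -> nrm y * nrm d <= / 2 ->
  exists z, is_inv (x - d)%A z /\ nrm z <= 2 * nrm y.
Proof.
move=> [H1 H2] Hd.
have Hs : nrm (y * d) <= / 2 by apply: Rle_trans (norm_subm _ _ _) Hd.
have [w [Hw Bw]] := @Neumann (y * d)%A ltac:(lra).
exists (w * y)%A; split.
  have -> : (x - d)%A = (x * (1 - y * d))%A.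
    have -> : (x * (1 - y * d))%A = (x - x * y * d)%A by nc.
    by rewrite H1 mul1l.
  exact: is_inv_mul.
apply: Rle_trans (norm_subm _ _ _) _; apply: Rmult_le_compat_r; first exact: norm_ge0.
have := norm_ge0 A w; nra.
Qed.

End Basics.

(** * Spectra of self-adjoint elements *)

Lemma Cabs_le z r : 0 <= r -> re z * re z + im z * im z <= r * r -> Cabs z <= r.
Proof.
by move=> Hr H; rewrite -(sqrt_square r Hr); apply: sqrt_le_1_alt.
Qed.

Definition unit_complex z := re z * re z + im z * im z = 1.

Lemma Cabs_unit z : unit_complex z -> Cabs z = 1.
Proof. by rewrite /Cabs => ->; exact: sqrt_1. Qed.

(** Half-angle formulas, with the sign of the imaginary part taken from that of [z]. *)
Lemma unit_complex_sqrt z : unit_complex z ->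
  exists w, unit_complex w /\ Cmul w w = z.
Proof.
case: z => c d; rewrite /unit_complex /= => H.
have Hc : -1 <= c <= 1 by split; nra.
pose u := sqrt ((1 + c) / 2); pose v := sqrt ((1 - c) / 2).
have Hu : u * u = (1 + c) / 2 by apply: sqrt_sqrt; lra.
have Hv : v * v = (1 - c) / 2 by apply: sqrt_sqrt; lra.
have Pu : 0 <= u := sqrt_pos _.
have Pv : 0 <= v := sqrt_pos _.
have Huv : (2 * (u * v)) * (2 * (u * v)) = d * d.
  have -> : (2 * (u * v)) * (2 * (u * v)) = 4 * (u * u) * (v * v) by ring.
  rewrite Hu Hv; lra.
have P : 0 <= u * v by apply: Rmult_le_pos.
case: (Rle_lt_dec 0 d) => Hd.
- exists (mkC u v); split=> /=; first lra.
  have E : 2 * (u * v) = d by nra.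
  by cplx; lra.
- exists (mkC u (- v)); split=> /=; first lra.
  have E : 2 * (u * v) = - d by nra.
  by cplx; lra.
Qed.

Section SelfAdjoint.
Context {A : CStarAlg}.
Implicit Types (x y h : A) (c d z : Cplx) (r s t : R).

Lemma is_inv_smul c d x y : Cmul c d = C1 -> is_inv x y ->
  is_inv (c *: x)%A (d *: y)%A.
Proof.
move=> H [H1 H2]; split; rewrite -smulMl -smulMr smulA ?H ?H1 ?smul1 //.
by rewrite (_ : Cmul d c = C1) ?smul1 // -H; cplx.
Qed.

(* Arens: adding a large imaginary multiple [i t] to [y] only raises the norm
   to [sqrt (|y|^2 + t^2) < |v + t|]. *)
Lemma sa_sub_imag_invertible y (v : R) : self_adjoint y -> v <> 0 ->
  invertible (y - mkC 0 v *: 1)%A.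
Proof.
(* Since [2 v t = |y|^2], the gap between [q^2] and [|y|^2 + t^2] is exactly [v^2]. *)
move=> Hy Hv; pose t := nrm y * nrm y / (2 * v); pose q := v + t.
have Ht : 2 * v * t = nrm y * nrm y by rewrite /t; field.
pose z := (y + mkC 0 t *: 1)%A.
have Hz : nrm z * nrm z <= nrm y * nrm y + t * t.
  have E : (z^* * z)%A = (y * y + (t * t) .* 1)%A.
    rewrite /z starD starZ star1 Hy.
    rewrite mulDl !mulDr -!smulMl -!smulMr !mul1l !mul1r smulA.
    have -> : (y * y + mkC 0 t *: y + (Cconj (mkC 0 t) *: y + Cmul (Cconj (mkC 0 t)) (mkC 0 t) *: 1))%A
      = (y * y + (mkC 0 t *: y + Cconj (mkC 0 t) *: y) + Cmul (Cconj (mkC 0 t)) (mkC 0 t) *: 1)%A by nc.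
    rewrite -smulDl (_ : Cadd _ _ = C0); last by cplx.
    rewrite smul0 addx0 /rsc; congr add; congr smul; cplx.
  rewrite -norm_cstar E.
  apply: Rle_trans (norm_triangle _ _ _) _; rewrite norm_sa_sqr // norm_rsc.
  rewrite Rabs_right; last by nra.
  have := @norm1_le1 A; have := norm_ge0 A 1%A; nra.
have Hq : nrm y * nrm y + t * t < q * q by rewrite /q; nra.
have Q0 : q <> 0 by move=> E; rewrite E in Hq; nra.
have Hn : nrm (mkC 0 (- / q) *: z) < 1.
  rewrite normZ.
  have -> : Cabs (mkC 0 (- / q)) = Rabs (/ q).
    by rewrite /Cabs /= -sqrt_Rsqr_abs /Rsqr; congr sqrt; ring.
  rewrite Rabs_inv; have P : 0 < Rabs q by apply: Rabs_pos_lt.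
  apply: (Rmult_lt_reg_l _ _ _ P); rewrite -Rmult_assoc Rinv_r ?Rmult_1_l ?Rmult_1_r; last lra.
  have E : q * q = Rabs q * Rabs q by rewrite -[LHS]/(Rsqr q) Rsqr_abs.
  have := norm_ge0 A z; nra.
have [w [Hw _]] := Neumann _ Hn.
have -> : (y - mkC 0 v *: 1)%A = (mkC 0 (- q) *: (1 - mkC 0 (- / q) *: z))%A.
  rewrite smulB smulA.
  rewrite (_ : Cmul _ _ = RtoC (Ropp 1)); last by cplx; field.
  rewrite -/(rsc _ _) -oppE /z subE.
  have -> : (mkC 0 (- q) *: 1 - - (y + mkC 0 t *: 1))%A = (y + (mkC 0 (- q) *: 1 + mkC 0 t *: 1))%A by nc.
  have -> : (- (mkC 0 v *: 1))%A = (RtoC (Ropp 1) *: (mkC 0 v *: 1))%A :> A by rewrite oppE.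
  by rewrite -smulDl smulA; congr add; congr smul; cplx; rewrite /q; ring.
apply: invertible_smul; last by exists w.
by case; lra.
Qed.

(* The Cayley transform [U] of [y] is unitary and [U - 1 = 2 i v w]. *)
Lemma sa_sub_imag_bound y (v : R) w : self_adjoint y -> v <> 0 ->
  is_inv (y - mkC 0 v *: 1)%A w -> nrm w * Rabs v <= 1.
Proof.
move=> Hy Hv Hw; set P := (y - mkC 0 v *: 1)%A in Hw.
pose K : A := (mkC 0 v *: 1)%A.
have KC x : (K * x)%A = (x * K)%A by rewrite /K -smulMl -smulMr mul1l mul1r.
have Q : (P^* )%A = (y + K)%A.
  rewrite /P starB Hy starZ star1 subE oppE /rsc smulA; congr add; congr smul; cplx.
have C : (P^* * P)%A = (P * P^* )%A.
  rewrite Q /P -/K.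
  have -> : ((y + K) * (y - K))%A = ((y - K) * (y + K) + (K * y - y * K) + (K * y - y * K))%A by nc.
  rewrite KC; nc.
pose U := (P^* * w)%A.
have HU : (U^* * U)%A = 1%A.
  have [W1 W2] := Hw; have [V1 V2] := is_inv_star Hw.
  rewrite /U starM starK.
  have -> : (w^* * P * (P^* * w))%A = (w^* * (P * P^* ) * w)%A by nc.
  rewrite -C.
  have -> : (w^* * (P^* * P) * w)%A = (w^* * P^* * (P * w))%A by nc.
  by rewrite W1 V2 mul1l.
have NU : nrm U <= 1.
  have := norm_cstar A U; rewrite HU; have := @norm1_le1 A; have := norm_ge0 A U; nra.
have E : (K * w + K * w)%A = (U - 1)%A.
  have [W1 _] := Hw; rewrite -W1 /U Q /P -/K; nc.
have NE : nrm (K * w + K * w) = 2 * (Rabs v * nrm w).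
  have -> : (K * w + K * w)%A = (2 .* (mkC 0 v *: w))%A.
    rewrite /K -smulMl mul1l (_ : 2 = 1 + 1) ?rscDl ?rsc1 //.
  rewrite norm_rsc normZ Rabs_right; last by lra.
  have -> // : Cabs (mkC 0 v) = Rabs v.
  by rewrite /Cabs /= -sqrt_Rsqr_abs /Rsqr; congr sqrt; ring.
have := norm_triangle_sub U 1%A; rewrite -E NE.
have := @norm1_le1 A; lra.
Qed.

Lemma sa_spec_real x z : self_adjoint x -> spec x z -> im z = 0.
Proof.
move=> Hx Hz; apply: NNPP => H; apply: Hz.
have -> : (x - z *: 1)%A = ((x - re z .* 1) - mkC 0 (im z) *: 1)%A.
  have -> : (z *: 1)%A = (re z .* 1 + mkC 0 (im z) *: 1)%A :> A.
    by rewrite /rsc -smulDl; congr smul; cplx.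
  nc.
by apply: sa_sub_imag_invertible => //; apply: saB => //; apply: sa_rsc; exact: sa1.
Qed.

(** A quantitative substitute for compactness of the circle. Points with imaginary part at least [e]
    in absolute value have the Cayley bound [/ e = 4 * C]. The others lie within [2 * e] of 1 or -1,
    and the choice [C * e = / 4] lets [perturb] act on the inverses given there. *)
Lemma resolvent_circle h : self_adjoint h -> nrm h = 1 ->
  invertible (1 - h)%A -> invertible (1 + h)%A ->
  exists M, 1 <= M /\ forall z, unit_complex z ->
    exists y, is_inv (1 - z *: h)%A y /\ nrm y <= M.
Proof.
move=> Hh Nh [a Ha] [b Hb].
pose C := nrm a + nrm b + 1.
have Na := norm_ge0 A a; have Nb := norm_ge0 A b.
have C1 : 1 <= C by rewrite /C; lra.
pose e := / (4 * C).
have HCe : C * e = / 4 by rewrite /e; field; lra.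
have E0 : 0 < e by apply: Rinv_0_lt_compat; lra.
exists (4 * C); split; first lra.
case=> c d Hz; have Hz' : c * c + d * d = 1 := Hz.
case: (Rle_lt_dec e (Rabs d)) => Hd.
  have D0 : - d <> 0 by move=> D; move: Hd; rewrite -Rabs_Ropp D Rabs_R0; lra.
  have Hs : self_adjoint (h - c .* 1)%A by apply: saB => //; apply: sa_rsc; exact: sa1.
  have [w Hw] := sa_sub_imag_invertible Hs D0.
  have Bw := sa_sub_imag_bound Hs D0 Hw.
  exists (mkC (- c) d *: w)%A; split.
    have -> : (1 - mkC c d *: h)%A = (mkC (- c) (- d) *: (h - c .* 1 - mkC 0 (- d) *: 1))%A.
      rewrite !smulB /rsc !smulA subE.
      have -> : (mkC (- c) (- d) *: h)%A = (- (mkC c d *: h))%A.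
        by rewrite oppE /rsc smulA; congr smul; cplx.
      have -> : (- (mkC c d *: h) - Cmul (mkC (- c) (- d)) (RtoC c) *: 1
          - Cmul (mkC (- c) (- d)) (mkC 0 (- d)) *: 1)%A
        = (- (Cmul (mkC (- c) (- d)) (RtoC c) *: 1
          + Cmul (mkC (- c) (- d)) (mkC 0 (- d)) *: 1) + - (mkC c d *: h))%A by nc.
      congr add; rewrite -smulDl oppE /rsc smulA -[LHS]smul1; congr smul; cplx; lra.
    by apply: is_inv_smul Hw; cplx; lra.
  rewrite normZ Cabs_unit ?Rmult_1_l; last by rewrite /unit_complex /=; lra.
  rewrite Rabs_Ropp in Bw; have := norm_ge0 A w => Nw.
  have : nrm w * e <= 1 by nra.
  move=> H; apply: (Rmult_le_reg_r e) => //.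
  have -> : 4 * C * e = 1 by lra.
  done.
have Hdd : d * d <= e * e by rewrite -[d * d]/(Rsqr d) Rsqr_abs /Rsqr; have := Rabs_pos d; nra.
case: (Rle_lt_dec 0 c) => Hc.
- have Hp : nrm (mkC (c - 1) d *: h) <= 2 * e.
    rewrite normZ Nh Rmult_1_r; apply: Cabs_le => /=; first lra.
    have : 1 - c <= d * d by nra.
    nra.
  have [||y [Hy By]] := @perturb _ (1 - h)%A a (mkC (c - 1) d *: h)%A => //.
    have : nrm a <= C by rewrite /C; lra.
    have := norm_ge0 A (mkC (c - 1) d *: h)%A; nra.
  exists y; split; last by rewrite /C in By |- *; lra.
  have -> // : (1 - mkC c d *: h)%A = (1 - h - mkC (c - 1) d *: h)%A.
  have -> : (mkC c d *: h)%A = (1 .* h + mkC (c - 1) d *: h)%A.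
    by rewrite /rsc -smulDl; congr smul; cplx.
  rewrite rsc1; nc.
- have Hp : nrm (mkC (c + 1) d *: h) <= 2 * e.
    rewrite normZ Nh Rmult_1_r; apply: Cabs_le => /=; first lra.
    have : 1 + c <= d * d by nra.
    nra.
  have [||y [Hy By]] := @perturb _ (1 + h)%A b (mkC (c + 1) d *: h)%A => //.
    have : nrm b <= C by rewrite /C; lra.
    have := norm_ge0 A (mkC (c + 1) d *: h)%A; nra.
  exists y; split; last by rewrite /C in By |- *; lra.
  have -> // : (1 - mkC c d *: h)%A = (1 + h - mkC (c + 1) d *: h)%A.
  have -> : (mkC (c + 1) d *: h)%A = (1 .* h + mkC c d *: h)%A.
    by rewrite /rsc -smulDl; congr smul; cplx.
  rewrite rsc1; nc.
Qed.

(** The power [x ^ (2 ^ n)]; only squarings occur because the C*-identity gives their norms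
    exactly. *)
Fixpoint sqr_iter x n := match n with O => x | S n => (sqr_iter x n * sqr_iter x n)%A end.

Lemma sqr_iter_sa x n : self_adjoint x -> self_adjoint (sqr_iter x n).
Proof. by move=> H; elim: n => //= n IH; apply: saM. Qed.

Lemma sqr_iter_norm_sa x n : self_adjoint x -> nrm x = 1 -> nrm (sqr_iter x n) = 1.
Proof.
by move=> H H1; elim: n => //= n IH; rewrite norm_sa_sqr ?IH ?Rmult_1_l //; exact: sqr_iter_sa.
Qed.

Lemma sqr_iter_norm_le x n : nrm x <= 1 -> nrm (sqr_iter x n) <= nrm x ^ S n.
Proof.
move=> H; have N0 := norm_ge0 A x; elim: n => [|n IH] /=; first lra.
apply: Rle_trans (norm_subm _ _ _) _; rewrite -/(nrm x ^ S n).
have P : 0 <= nrm x ^ S n by apply: pow_le.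
have Q : nrm x ^ n <= 1 by rewrite -(pow1 n); apply: pow_incr.
have N1 := norm_ge0 A (sqr_iter x n).
have : nrm (sqr_iter x n) <= nrm x.
  apply: Rle_trans IH _; rewrite /= -[X in _ <= X]Rmult_1_r; exact: Rmult_le_compat_l.
move=> H2; apply: Rle_trans (Rmult_le_compat _ _ _ _ N1 N1 H2 IH) _; rewrite /=; lra.
Qed.

(** Partial fractions for [1 / (1 - x^2)]. *)
Lemma is_inv_sqr x a b : is_inv (1 - x)%A a -> is_inv (1 + x)%A b ->
  is_inv (1 - x * x)%A (/ 2 .* (a + b))%A.
Proof.
move=> [A1 A2] [B1 B2].
have E1 : ((1 - x * x) * (a + b))%A = (1 + 1)%A.
  have -> : ((1 - x * x) * (a + b))%A = ((1 + x) * ((1 - x) * a) + (1 - x) * ((1 + x) * b))%A by nc.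
  rewrite A1 B1; nc.
have E2 : ((a + b) * (1 - x * x))%A = (1 + 1)%A.
  have -> : ((a + b) * (1 - x * x))%A = ((a * (1 - x)) * (1 + x) + (b * (1 + x)) * (1 - x))%A by nc.
  rewrite A2 B2; nc.
by split; rewrite -?rscMr -?rscMl ?E1 ?E2 rsc_half.
Qed.

(** By [is_inv_sqr], the resolvent of a square at [w^2] is the mean of the resolvents at [w] and
    [-w]. A mean of two differences of norm at most [e] is again at most [e], so nothing is lost as
    [n] grows. *)
Lemma resolvent_sqr_iter h g e n :
  (forall z, unit_complex z -> exists a b,
    is_inv (1 - z *: h)%A a /\ is_inv (1 - z *: g)%A b /\ nrm (a - b) <= e) ->
  forall z, unit_complex z -> exists a b,
    is_inv (1 - z *: sqr_iter h n)%A a /\ is_inv (1 - z *: sqr_iter g n)%A b /\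
    nrm (a - b) <= e.
Proof.
move=> H; elim: n => [//|n IH] z Hz.
have [w [Hw <-]] := unit_complex_sqrt Hz.
have Hw' : unit_complex (mkC (- re w) (- im w)) by move: Hw; rewrite /unit_complex /=; lra.
have [a [b [Ha [Hb Hab]]]] := IH _ Hw.
have [a' [b' [Ha' [Hb' Hab']]]] := IH _ Hw'.
have E x : (1 - mkC (- re w) (- im w) *: x)%A = (1 + w *: x)%A.
  have -> : (mkC (- re w) (- im w) *: x)%A = (- (w *: x))%A.
    by rewrite oppE /rsc smulA; congr smul; cplx.
  nc.
rewrite E in Ha'; rewrite E in Hb'.
have E2 x : (Cmul w w *: (x * x))%A = (w *: x * (w *: x))%A.
  by rewrite -smulMl -smulMr smulA.
exists (/ 2 .* (a + a'))%A, (/ 2 .* (b + b'))%A; rewrite /= !E2.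
split; first exact: is_inv_sqr.
split; first exact: is_inv_sqr.
rewrite -rscB norm_rsc Rabs_right; last lra.
have -> : (a + a' - (b + b'))%A = ((a - b) + (a' - b'))%A by nc.
have := norm_triangle A (a - b)%A (a' - b')%A; lra.
Qed.

(* Rickart's elementary proof of the spectral radius formula: averaging over
   roots of unity, the distance between the resolvents of [h^N] and [(s h)^N] at
   [1] is bounded independently of [N], while the second one tends to [1]. *)
Lemma sa_norm1_spec h : self_adjoint h -> nrm h = 1 ->
  ~ (invertible (1 - h)%A /\ invertible (1 + h)%A).
Proof.
move=> Hh Nh [H1 H2].
have [M [M1 HM]] := resolvent_circle Hh Nh H1 H2.
(* Below, [a - b = - a k b] with norms at most [M], [1 - s] and [2 * M], and this [s] makes the
   product at most [/ 8]. *)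
pose s := 1 - / (16 * (M * M)).
have MM : 1 <= M * M by nra.
have Hs : (1 - s) * (M * M) = / 16 by rewrite /s; field; lra.
have S1 : 0 < 1 - s by rewrite /s; have := Rinv_0_lt_compat (16 * (M * M)) ltac:(lra); lra.
have S0 : / 2 <= s.
  rewrite /s; suff : / (16 * (M * M)) <= / 2 by lra.
  apply: Rinv_le_contravar; lra.
have HSM : M * (1 - s) <= / 16 by nra.
pose g := (s .* h)%A.
have Ng : nrm g = s by rewrite norm_rsc Nh Rabs_right; lra.
have Base z : unit_complex z -> exists a b,
    is_inv (1 - z *: h)%A a /\ is_inv (1 - z *: g)%A b /\ nrm (a - b) <= / 8.
  move=> Hz; have [a [Ha Na]] := HM z Hz.
  pose k := ((1 - s) .* (- (z *: h)))%A.
  have Nk : nrm k = 1 - s.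
    by rewrite norm_rsc normN normZ Nh Cabs_unit // Rabs_right; lra.
  have Eg : (1 - z *: g)%A = (1 - z *: h - k)%A.
    rewrite /k /g /rsc smulA.
    have -> : (Cmul z (RtoC s) *: h)%A = (z *: h - (1 - s) .* (z *: h))%A.
      have -> : (z *: h - (1 - s) .* (z *: h))%A = (1 .* (z *: h) + (- (1 - s)) .* (z *: h))%A.
        by rewrite rsc1 rscN.
      by rewrite /rsc -smulDl smulA; congr smul; cplx.
    rewrite /rsc smulN; nc.
  have [|b [Hb Nb]] := @perturb _ (1 - z *: h)%A a k Ha.
    by rewrite Nk; have := norm_ge0 A a; nra.
  rewrite -Eg in Hb; exists a, b; do 2 split=> //.
  have -> : (a - b)%A = (- (a * k * b))%A.
    have [Ha1 Ha2] := Ha; have [Hb1 Hb2] := Hb; rewrite Eg in Hb1.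
    have -> : (a - b)%A = (a * ((1 - z *: h - k) * b) - (a * (1 - z *: h)) * b)%A.
      by rewrite Hb1 Ha2 mul1l mul1r.
    nc.
  rewrite normN; apply: Rle_trans (norm_subm _ _ _) _.
  have N1 := norm_subm A a k; rewrite Nk in N1.
  have Na0 := norm_ge0 A a; have Nb0 := norm_ge0 A b.
  have : nrm (a * k) * nrm b <= (M * (1 - s)) * (2 * M).
    apply: Rmult_le_compat => //; [exact: norm_ge0 | nra | lra].
  nra.
have [N HN] := pow_lt_1_zero s ltac:(rewrite Rabs_right; lra) (/ 8) ltac:(lra).
have Hu : unit_complex C1 by rewrite /unit_complex /=; ring.
have [a [b [Ha [Hb Hab]]]] := @resolvent_sqr_iter h g (/ 8) N Base C1 Hu.
rewrite !smul1 in Ha Hb.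
set H := sqr_iter h N in Ha; set G := sqr_iter g N in Hb.
have NG : nrm G <= / 8.
  have := HN (S N) ltac:(lia); rewrite Rabs_right; last by apply: Rle_ge; apply: pow_le; lra.
  have := @sqr_iter_norm_le g N ltac:(lra); rewrite Ng; rewrite /G; lra.
have NH : nrm H = 1 by exact: sqr_iter_norm_sa.
have N1 := @norm1_le1 A.
have NG0 := norm_ge0 A G.
have Nb1 : nrm (b - 1) <= / 7.
  have Eb : (b - 1)%A = (G * b)%A by have [<- _] := Hb; nc.
  have L1 := norm_subm A G b; rewrite -Eb in L1.
  have L2 := norm_le_sub b 1%A.
  have L3 : nrm G * nrm b <= / 8 * nrm b by apply: Rmult_le_compat_r => //; exact: norm_ge0.
  lra.
have Na1 : nrm (1 - a) <= / 3.
  have := norm_sub_le 1%A b a; rewrite (norm_subC 1%A b) (norm_subC b a); lra.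
(* The contradiction: taking norms gives [1 = nrm H <= 2 * / 3]. *)
have EH : H = (- ((1 - H) * (1 - a)))%A.
  have [E _] := Ha.
  have -> : (- ((1 - H) * (1 - a)))%A = ((1 - H) * a - (1 - H))%A by nc.
  rewrite E; nc.
have L1 := norm_subm A (1 - H)%A (1 - a)%A.
have L2 := norm_triangle_sub 1%A H.
have L3 : nrm H = nrm ((1 - H) * (1 - a)) by rewrite {1}EH normN.
have := norm_ge0 A (1 - H)%A; have := norm_ge0 A (1 - a)%A; nra.
Qed.

(** Rescaling to norm 1, [sa_norm1_spec] puts [nrm x] or [- nrm x] into the spectrum. *)
Lemma sa_norm_le_spec x r : self_adjoint x -> 0 <= r ->
  (forall t, specR x t -> Rabs t <= r) -> nrm x <= r.
Proof.
move=> Hx Hr H; apply: Rnot_lt_le => Hn.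
pose n := nrm x; have n0 : 0 < n by rewrite /n; lra.
apply: (@sa_norm1_spec (/ n .* x)%A); first exact: sa_rsc.
  rewrite norm_rsc Rabs_right; last by apply: Rle_ge; apply: Rlt_le; apply: Rinv_0_lt_compat.
  by rewrite -/n; field; lra.
have Inv t : Rabs t = n -> invertible (x - RtoC t *: 1)%A.
  by move=> Ht; apply: NNPP => Hs; have := H t Hs; rewrite Ht /n; lra.
have Cn t : t <> 0 -> RtoC t <> C0 by move=> Ht; case.
have I0 : / n <> 0 by apply: Rinv_neq_0_compat; lra.
split.
- have -> : (1 - / n .* x)%A = (RtoC (- / n) *: (x - RtoC n *: 1))%A.
    rewrite smulB smulA.
    rewrite (_ : Cmul _ _ = RtoC (Ropp 1)); last by cplx; field; lra.
    rewrite -!/(rsc _ _) -oppE rscN; nc.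
  apply: invertible_smul; first by apply: Cn; lra.
  by apply: Inv; rewrite Rabs_right //; lra.
- have -> : (1 + / n .* x)%A = (RtoC (/ n) *: (x - RtoC (- n) *: 1))%A.
    rewrite smulB smulA.
    rewrite (_ : Cmul _ _ = RtoC (Ropp 1)); last by cplx; field; lra.
    rewrite -!/(rsc _ _) -oppE; nc.
  apply: invertible_smul; first by apply: Cn.
  by apply: Inv; rewrite Rabs_Ropp Rabs_right //; lra.
Qed.

End SelfAdjoint.

(** * Functional calculus of self-adjoint elements *)

Definition Copp z := mkC (- re z) (- im z).
Definition Csub z w := Cadd z (Copp w).

Lemma Cplx_ring : ring_theory C0 C1 Cadd Cmul Csub Copp eq.
Proof. by split=> *; cplx. Qed.
Add Ring Cplx_ring : Cplx_ring.

Definition reval (p : list R) (t : R) : R := fold_right (fun c acc => c + t * acc) 0 p.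

Lemma ceval_RtoC p t : ceval (map RtoC p) (RtoC t) = RtoC (reval p t).
Proof. by elim: p => //= c p ->; cplx. Qed.

(* The quotient of [c + X q] by [X - z] (Horner's scheme). *)
Fixpoint horner_quo (q : list Cplx) (z : Cplx) : list Cplx :=
  match q with nil => nil | _ :: q' => ceval q z :: horner_quo q' z end.

Lemma horner_quo_length q z : length (horner_quo q z) = length q.
Proof. by elim: q => //= c q ->. Qed.

Lemma ceval_horner_quo c q z w : ceval (c :: q) w =
  Cadd (ceval (c :: q) z) (Cmul (Csub w z) (ceval (horner_quo q z) w)).
Proof.
elim: q c => [|d q IH] c; first by rewrite /=; ring.
have := IH d.
change (ceval (c :: d :: q) w) with (Cadd c (Cmul w (ceval (d :: q) w))).
change (ceval (c :: d :: q) z) with (Cadd c (Cmul z (ceval (d :: q) z))).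
change (ceval (horner_quo (d :: q) z) w) with
  (Cadd (ceval (d :: q) z) (Cmul w (ceval (horner_quo q z) w))).
move=> ->; ring.
Qed.

Fixpoint padd (p q : list R) : list R :=
  match p, q with
  | nil, _ => q
  | _, nil => p
  | c :: p', d :: q' => (c + d) :: padd p' q'
  end.

Fixpoint pmul (p q : list R) : list R :=
  match p with nil => nil | c :: p' => padd (map (Rmult c) q) (0 :: pmul p' q) end.

Lemma reval_padd p q t : reval (padd p q) t = reval p t + reval q t.
Proof.
elim: p q => [|c p IH] [|d q] /=; try ring.
by rewrite -/(reval _ _) IH -!/(reval _ _); ring.
Qed.

Lemma reval_pscale c p t : reval (map (Rmult c) p) t = c * reval p t.
Proof. by elim: p => [|d p IH] /=; rewrite -?/(reval _ _) ?IH; ring. Qed.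

Lemma reval_pmul p q t : reval (pmul p q) t = reval p t * reval q t.
Proof.
elim: p => [|c p IH] /=; first ring.
by rewrite reval_padd reval_pscale /= -/(reval _ _) IH; ring.
Qed.

Section FunctionalCalculus.
Context {A : CStarAlg}.
Implicit Types (x y : A) (r s t : R).

Fixpoint cpeval (p : list Cplx) x : A :=
  match p with nil => 0%A | c :: q => (c *: 1 + x * cpeval q x)%A end.

Lemma cpeval_RtoC p x : cpeval (map RtoC p) x = peval p x.
Proof. by elim: p => //= c p ->. Qed.

Lemma smul1_comm c x : (c *: 1 * x)%A = (x * (c *: 1))%A.
Proof. by rewrite -smulMl -smulMr mul1l mul1r. Qed.

Lemma smul1_mul c d : (Cmul c d *: 1)%A = (c *: 1 * (d *: 1))%A :> A.
Proof. by rewrite -smulMl mul1l smulA. Qed.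

Lemma cpeval_comm p x : (x * cpeval p x)%A = (cpeval p x * x)%A.
Proof.
elim: p => [|c p IH] /=; first nc.
rewrite mulDl mulDr smul1_comm -mulA IH; nc.
Qed.

Lemma cpeval_horner_quo c q z x : (cpeval (c :: q) x - ceval (c :: q) z *: 1)%A =
  ((x - z *: 1) * cpeval (horner_quo q z) x)%A.
Proof.
elim: q c => [|d q IH] c.
  rewrite /= smulDl (_ : Cmul z C0 = C0) ?smul0; last by cplx.
  nc.
have {}IH := IH d.
change (cpeval (c :: d :: q) x) with (c *: 1 + x * cpeval (d :: q) x)%A.
change (ceval (c :: d :: q) z) with (Cadd c (Cmul z (ceval (d :: q) z))).
change (cpeval (horner_quo (d :: q) z) x) with
  (ceval (d :: q) z *: 1 + x * cpeval (horner_quo q z) x)%A.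
rewrite smulDl smul1_mul.
have -> : ((x - z *: 1) * (ceval (d :: q) z *: 1 + x * cpeval (horner_quo q z) x))%A =
  ((x - z *: 1) * (ceval (d :: q) z *: 1) +
   (x * x - (z *: 1) * x) * cpeval (horner_quo q z) x)%A by nc.
rewrite (smul1_comm z x).
have -> : ((x * x - x * (z *: 1)) * cpeval (horner_quo q z) x)%A =
  (x * ((x - z *: 1) * cpeval (horner_quo q z) x))%A by nc.
rewrite -IH; nc.
Qed.

Lemma invertible_mul x y : invertible x -> invertible y -> invertible (x * y)%A.
Proof. by move=> [a Ha] [b Hb]; exists (b * a)%A; exact: is_inv_mul. Qed.

Lemma invertible1 : invertible (1%A : A).
Proof. by exists 1%A; rewrite mul1l. Qed.

(** The half of spectral mapping that rests on the fundamental theorem of algebra. A root outside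
    the spectrum splits off an invertible linear factor, which leaves a shorter noninvertible
    quotient. The given spectral point serves when all coefficients vanish. *)
Lemma cpeval_not_invertible x p : (exists z, spec x z) ->
  ~ invertible (cpeval p x) -> exists z, spec x z /\ ceval p z = C0.
Proof.
move=> [w Hw]; have [n Hn] : exists n, (length p <= n)%nat by exists (length p).
elim: n p Hn => [|n IH] [|c q] Hn Hp; try by exists w.
  by rewrite /= in Hn; lia.
have [H0|[z Hz]] := FTA.ceval_root c q.
  have E z : cpeval q x = 0%A /\ ceval q z = C0.
    elim: q {Hn Hp IH} H0 => //= d q IH H0.
    have [|-> ->] := IH; first by move=> u Hu; apply: H0; right.
    rewrite (H0 d); last by left.
    split; last by cplx.
    rewrite smul0; nc.
  case: (classic (c = C0)) => Hc.
    exists w; split=> //=; have [_ ->] := E w.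
    by rewrite Hc; cplx.
  case: Hp; rewrite /=; have [-> _] := E w.
  have -> : (c *: 1 + x * 0)%A = (c *: 1)%A by nc.
  by apply: invertible_smul => //; exact: invertible1.
case: (classic (spec x z)) => Hs; first by exists z.
have [||u [Hu Eu]] := IH (horner_quo q z).
- by rewrite horner_quo_length; rewrite /= in Hn; lia.
- move=> Hi; apply: Hp.
  have -> : cpeval (c :: q) x = (cpeval (c :: q) x - ceval (c :: q) z *: 1)%A.
    rewrite Hz smul0; nc.
  rewrite cpeval_horner_quo; apply: invertible_mul => //; exact: NNPP.
exists u; split=> //; rewrite (ceval_horner_quo c q z u) Hz Eu; ring.
Qed.

Lemma norm_lt_invertible x t : nrm x < Rabs t -> invertible (x - t .* 1)%A.
Proof.
move=> Ht; have N0 := norm_ge0 A x.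
have T0 : t <> 0 by move=> E; rewrite E Rabs_R0 in Ht; lra.
have -> : (x - t .* 1)%A = ((- t) .* (1 - / t .* x))%A.
  rewrite rscB rscA (_ : - t * / t = Ropp 1); last by field.
  rewrite rscN -oppE; nc.
apply: invertible_smul; first by case; lra.
have [|y [Hy _]] := @Neumann _ (/ t .* x)%A; last by exists y.
have P : 0 < Rabs t by apply: Rabs_pos_lt.
rewrite norm_rsc Rabs_inv; apply: (Rmult_lt_reg_l _ _ _ P).
by rewrite -Rmult_assoc Rinv_r ?Rmult_1_l ?Rmult_1_r //; lra.
Qed.

Lemma specR_le_norm x t : specR x t -> Rabs t <= nrm x.
Proof.
move=> H; apply: Rnot_lt_le => Hlt; apply: H; exact: norm_lt_invertible.
Qed.

(** The other half: [x - t] is a commuting factor of [p(x) - p(t)]. For [nil] the element is 0,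
    which is invertible only in the zero algebra, where spectra are empty. *)
Lemma peval_specR p x t : specR x t -> specR (peval p x) (reval p t).
Proof.
case: p => [|c q] Ht.
  move=> /= [y [Hy _]]; apply: Ht; exists 0%A.
  rewrite smul0 in Hy.
  have E : 1%A = 0%A :> A by rewrite -Hy; nc.
  by split; rewrite -[RHS]mul1l E; nc.
move=> H; apply: Ht.
have E := cpeval_horner_quo (RtoC c) (map RtoC q) (RtoC t) x.
rewrite -!map_cons cpeval_RtoC ceval_RtoC in E; rewrite E in H.
apply: invertible_factor H.
set Q := cpeval _ _.
have -> : ((x - RtoC t *: 1) * Q)%A = (x * Q - RtoC t *: 1 * Q)%A by nc.
rewrite cpeval_comm smul1_comm; nc.
Qed.

Lemma peval_sa p x : self_adjoint x -> self_adjoint (peval p x).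
Proof.
move=> Hx; elim: p => [|c p IH] /=; first exact: sa0.
apply: saD; first by apply: sa_rsc; exact: sa1.
by apply: saM => //; rewrite -cpeval_RtoC cpeval_comm.
Qed.

(** The noninvertible [y] excludes the zero algebra. An empty spectrum would force [nrm x = 0], but
    0 is a spectral point of the zero element. *)
Lemma sa_spec_nonempty x y : self_adjoint x -> ~ invertible y -> exists z, spec x z.
Proof.
move=> Hx Hy; apply: NNPP => H; apply: Hy.
have N : nrm x <= 0.
  by apply: sa_norm_le_spec => // [|t Ht]; [lra | case: H; exists (RtoC t)].
have X0 : x = 0%A by apply: norm_eq0; have := norm_ge0 A x; lra.
have [z [Hz _]] : invertible x.
  apply: NNPP => Hi; apply: H; exists C0; rewrite /spec smul0.
  by have -> : (x - 0)%A = x by nc.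
have E : 1%A = 0%A :> A by rewrite -Hz X0; nc.
by exists 0%A; split; rewrite -[RHS]mul1l E; nc.
Qed.

(** Spectral radius and spectral mapping combined: polynomials uniformly close on the spectrum have
    values close in norm, which gives existence and uniqueness of the calculus. *)
Lemma peval_norm_le p x r : self_adjoint x -> 0 <= r ->
  (forall t, specR x t -> Rabs (reval p t) <= r) -> nrm (peval p x) <= r.
Proof.
move=> Hx Hr H; apply: sa_norm_le_spec => //; first exact: peval_sa.
move=> s Hs.
have E : (peval p x - s .* 1)%A = cpeval (map RtoC (padd p (- s :: nil))) x.
  rewrite cpeval_RtoC; case: p {H Hs} => [|c p] /=; first by rewrite rscN; nc.
  have -> : padd p nil = p by case: p.
  rewrite rscDl rscN; nc.
have Hn := Hs; rewrite /specR /spec -/(rsc s _) E in Hn.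
have [z [Hz Ez]] := cpeval_not_invertible _ (sa_spec_nonempty Hx Hs) Hn.
have Zr : z = RtoC (re z) by apply: Cplx_ext => //=; exact: (sa_spec_real Hx Hz).
rewrite Zr ceval_RtoC reval_padd /= in Ez.
have {}Ez : reval p (re z) = s by case: Ez; lra.
by rewrite -Ez; apply: H; rewrite /specR -Zr.
Qed.

Lemma peval_padd p q x : peval (padd p q) x = (peval p x + peval q x)%A.
Proof.
elim: p q => [|c p IH] [|d q] /=; try nc.
rewrite IH rscDl; nc.
Qed.

Lemma peval_pscale c p x : peval (map (Rmult c) p) x = (c .* peval p x)%A.
Proof.
elim: p => [|d p IH] /=; first by rewrite rscx0.
by rewrite IH -rscMr rscDr rscA.
Qed.

Lemma peval_pmul p q x : peval (pmul p q) x = (peval p x * peval q x)%A.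
Proof.
elim: p => [|c p IH] /=; first nc.
rewrite peval_padd peval_pscale /= IH rsc0 mulDl -rscMl mul1l; nc.
Qed.

Section OneElement.
Variable x : A.
Hypothesis Hx : self_adjoint x.
Implicit Types (f g : R -> R) (z : A).

Lemma fc_ext f g y : (forall t, specR x t -> f t = g t) ->
  is_fcalc x f y -> is_fcalc x g y.
Proof.
move=> E H e He; have [p [H1 H2]] := H e He; exists p; split=> // t Ht.
by rewrite -E //; exact: H1.
Qed.

Lemma fc_norm_le f y r : 0 <= r -> is_fcalc x f y ->
  (forall t, specR x t -> Rabs (f t) <= r) -> nrm y <= r.
Proof.
move=> Hr Hf Hb; apply: le_epsilon => e He.
have [p [H1 H2]] := Hf (e / 2) ltac:(lra).
have := norm_le_sub y (peval p x).
have : nrm (peval p x) <= r + e / 2; last by lra.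
apply: peval_norm_le => //; first lra.
move=> t Ht; have := Hb t Ht; have := H1 t Ht; rewrite -/(reval p t).
have := Rabs_triang (f t) (- (f t - reval p t)); rewrite Rabs_Ropp.
have -> : f t + - (f t - reval p t) = reval p t by ring.
lra.
Qed.

Lemma fc_bound f y t : is_fcalc x f y -> specR x t -> Rabs (f t) <= nrm y.
Proof.
move=> Hf Ht; apply: le_epsilon => e He.
have [p [H1 H2]] := Hf (e / 2) ltac:(lra).
have := specR_le_norm (peval_specR p Ht); have := H1 t Ht; rewrite -/(reval p t).
have := norm_le_sub (peval p x) y; rewrite norm_subC.
have := Rabs_triang (f t - reval p t) (reval p t).
have -> : f t - reval p t + reval p t = f t by ring.
lra.
Qed.

Lemma fc_peval p : is_fcalc x (reval p) (peval p x).
Proof.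
move=> e He; exists p; split.
  by move=> t _; rewrite -/(reval p t) Rminus_diag Rabs_R0; lra.
by rewrite (_ : (_ - _)%A = 0%A) ?norm0; [lra | nc].
Qed.

Lemma fc_const c : is_fcalc x (fun _ => c) (c .* 1)%A.
Proof.
have H := fc_peval (c :: nil).
have -> : (c .* 1)%A = peval (c :: nil) x by rewrite /=; nc.
by apply: fc_ext H => t _ /=; ring.
Qed.

Lemma fc_id : is_fcalc x (fun t => t) x.
Proof.
have H := fc_peval (0 :: 1 :: nil).
have {2}-> : x = peval (0 :: 1 :: nil) x by rewrite /= rsc0 rsc1; nc.
by apply: fc_ext H => t _ /=; ring.
Qed.

Lemma fc_add f g y z : is_fcalc x f y -> is_fcalc x g z ->
  is_fcalc x (fun t => f t + g t) (y + z)%A.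
Proof.
move=> Hf Hg e He.
have [p [F1 F2]] := Hf (e / 2) ltac:(lra).
have [q [G1 G2]] := Hg (e / 2) ltac:(lra).
exists (padd p q); split.
  move=> t Ht; rewrite -/(reval _ t) reval_padd.
  have := F1 t Ht; have := G1 t Ht; rewrite -!/(reval _ t).
  have -> : f t + g t - (reval p t + reval q t) = (f t - reval p t) + (g t - reval q t) by ring.
  have := Rabs_triang (f t - reval p t) (g t - reval q t); lra.
rewrite peval_padd.
have -> : (y + z - (peval p x + peval q x))%A = ((y - peval p x) + (z - peval q x))%A by nc.
have := norm_triangle A (y - peval p x)%A (z - peval q x)%A; lra.
Qed.

Lemma fc_mul f g y z : is_fcalc x f y -> is_fcalc x g z ->
  is_fcalc x (fun t => f t * g t) (y * z)%A.
Proof.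
move=> Hf Hg e He.
have Ny := norm_ge0 A y; have Nz := norm_ge0 A z.
pose K := nrm y + nrm z + 1.
pose d := Rmin 1 (e / K).
have D0 : 0 < d by apply: Rmin_pos; [lra | apply: Rdiv_lt_0_compat; rewrite /K; lra].
have D1 : d <= 1 by exact: Rmin_l.
have D2 : d * K <= e.
  have : d <= e / K by exact: Rmin_r.
  have K0 : 0 < K by rewrite /K; lra.
  move=> H; have -> : e = e / K * K by field; lra.
  by apply: Rmult_le_compat_r => //; lra.
have [p [F1 F2]] := Hf d D0.
have [q [G1 G2]] := Hg d D0.
(* One estimate for both halves of the definition: for scalars on the spectrum, where [fc_bound]
   bounds [f] and [g] by the norms of [y] and [z], and for elements. *)
have B a b c c' : 0 <= a -> 0 <= b -> 0 <= c <= d -> 0 <= c' <= d ->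
  a <= nrm y -> b <= nrm z + d -> a * c + c' * b <= e.
  move=> Ha Hb Hc Hc' Hay Hbz.
  have : a * c <= nrm y * d by apply: Rmult_le_compat; lra.
  have : c' * b <= d * (nrm z + d) by apply: Rmult_le_compat; lra.
  rewrite /K in D2; nra.
exists (pmul p q); split.
  move=> t Ht; rewrite -/(reval _ t) reval_pmul.
  have Ft := F1 t Ht; have Gt := G1 t Ht; rewrite -!/(reval _ t) in Ft Gt.
  have -> : f t * g t - reval p t * reval q t =
    f t * (g t - reval q t) + (f t - reval p t) * reval q t by ring.
  apply: Rle_trans (Rabs_triang _ _) _; rewrite !Rabs_mult.
  apply: B; try exact: Rabs_pos; try by split=> //; exact: Rabs_pos.
    exact: fc_bound.
  have := fc_bound Hg Ht.
  have := Rabs_triang (g t) (- (g t - reval q t)); rewrite Rabs_Ropp.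
  have -> : g t + - (g t - reval q t) = reval q t by ring.
  lra.
rewrite peval_pmul.
have -> : (y * z - peval p x * peval q x)%A =
  (y * (z - peval q x) + (y - peval p x) * peval q x)%A by nc.
apply: Rle_trans (norm_triangle _ _ _) _.
have := norm_subm A y (z - peval q x)%A.
have := norm_subm A (y - peval p x)%A (peval q x).
suff : nrm y * nrm (z - peval q x) + nrm (y - peval p x) * nrm (peval q x) <= e by lra.
apply: B; try exact: norm_ge0; try by split=> //; exact: norm_ge0.
  lra.
have := norm_le_sub (peval q x) z; rewrite norm_subC; lra.
Qed.

Lemma fc_scale c f y : is_fcalc x f y -> is_fcalc x (fun t => c * f t) (c .* y)%A.
Proof.
move=> H; have -> : (c .* y)%A = (c .* 1 * y)%A by rewrite -rscMl mul1l.
by apply: fc_mul => //; exact: fc_const.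
Qed.

Lemma fc_sub f g y z : is_fcalc x f y -> is_fcalc x g z ->
  is_fcalc x (fun t => f t - g t) (y - z)%A.
Proof.
move=> Hf Hg; rewrite subE oppE.
have := fc_add Hf (fc_scale (Ropp 1) Hg).
by apply: fc_ext => t _; ring.
Qed.

Lemma fc_unique f y z : is_fcalc x f y -> is_fcalc x f z -> y = z.
Proof.
move=> Hy Hz; apply: sub_eq0; apply: norm_small => e He.
apply: (fc_norm_le (Rlt_le _ _ He) (fc_sub Hy Hz)) => t _.
by rewrite Rminus_diag Rabs_R0; lra.
Qed.

Lemma fc_sa f y : is_fcalc x f y -> self_adjoint y.
Proof.
move=> H; apply: sub_eq0; apply: norm_small => e He.
have [p [_ H2]] := H (e / 2) ltac:(lra).
have := norm_sub_le (y^* )%A (peval p x) y.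
have -> : nrm (y^* - peval p x) = nrm (y - peval p x).
  by rewrite -{1}(peval_sa p Hx) -starB norm_star.
rewrite (norm_subC (peval p x) y); lra.
Qed.

(** Invertibility is stable under small perturbations: an inverse of [y - f(t)] would yield one of
    [p(x) - p(t)] for a close polynomial [p], against [peval_specR]. *)
Lemma fc_specR f y t : is_fcalc x f y -> specR x t -> specR y (f t).
Proof.
move=> H Ht [w Hw].
pose e := / (4 * (nrm w + 1)).
have Nw := norm_ge0 A w.
have He : 0 < e by apply: Rinv_0_lt_compat; lra.
have Ee : nrm w * (e + e) <= / 2.
  have : (nrm w + 1) * e = / 4 by rewrite /e; field; lra.
  nra.
have [p [H1 H2]] := H e He.
have := peval_specR p Ht; apply.
have Ft := H1 t Ht; rewrite -/(reval p t) in Ft.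
pose d := ((y - peval p x) - (f t - reval p t) .* 1)%A.
have [|z [Hz _]] := @perturb _ (y - RtoC (f t) *: 1)%A w d Hw.
  apply: Rle_trans Ee; apply: Rmult_le_compat_l => //.
  have := norm_triangle_sub (y - peval p x)%A ((f t - reval p t) .* 1)%A.
  rewrite norm_rsc.
  have : Rabs (f t - reval p t) * nrm (1%A : A) <= e * 1.
    by apply: Rmult_le_compat => //; [exact: Rabs_pos | exact: norm_ge0 | exact: norm1_le1].
  rewrite /d; lra.
exists z.
suff <- : (y - RtoC (f t) *: 1 - d)%A = (peval p x - RtoC (reval p t) *: 1)%A by [].
rewrite /d (_ : f t - reval p t = f t + - reval p t) // rscDl rscN /rsc; nc.
Qed.

Lemma fc_reval f y p : is_fcalc x f y ->
  is_fcalc x (fun t => reval p (f t)) (peval p y).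
Proof.
move=> Hf; elim: p => [|c p IH] /=.
  by have := fc_const 0; rewrite rsc0.
exact: fc_add (fc_const c) (fc_mul Hf IH).
Qed.

Lemma fc_comp f g y z : is_fcalc x f y -> is_fcalc y g z ->
  is_fcalc x (fun t => g (f t)) z.
Proof.
move=> Hf Hg e He.
have [p [G1 G2]] := Hg (e / 2) ltac:(lra).
have [q [F1 F2]] := fc_reval p Hf (eps := e / 2) ltac:(lra).
exists q; split.
  move=> t Ht.
  have := G1 _ (fc_specR Hf Ht); have := F1 t Ht; rewrite -!/(reval _ _).
  have := Rabs_triang (g (f t) - reval p (f t)) (reval p (f t) - reval q t).
  have -> : g (f t) - reval p (f t) + (reval p (f t) - reval q t) = g (f t) - reval q t by ring.
  lra.
have := norm_sub_le z (peval p y) (peval q x); lra.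
Qed.

End OneElement.
End FunctionalCalculus.

(** * Bernstein partitions of unity and existence of the calculus *)

Section ListSums.
Variable X : Type.
Implicit Types (F G : X -> R) (l : list X).

Definition lsum F l := fold_right (fun x acc => F x + acc) 0 l.

Lemma lsum_app F l l' : lsum F (l ++ l') = lsum F l + lsum F l'.
Proof. by elim: l => [|x l IH] /=; rewrite ?IH; ring. Qed.

Lemma lsum_ext F G l : (forall x, F x = G x) -> lsum F l = lsum G l.
Proof. by move=> H; elim: l => //= x l ->; rewrite H. Qed.

Lemma lsum_add F G l : lsum (fun x => F x + G x) l = lsum F l + lsum G l.
Proof. by elim: l => [|x l IH] /=; rewrite ?IH; ring. Qed.

Lemma lsum_scale c F l : lsum (fun x => c * F x) l = c * lsum F l.
Proof. by elim: l => [|x l IH] /=; rewrite ?IH; ring. Qed.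

Lemma lsum_le F G l : (forall x, In x l -> F x <= G x) -> lsum F l <= lsum G l.
Proof.
elim: l => [|x l IH] /= H; first lra.
have := H x (or_introl eq_refl); have := IH (fun y Hy => H y (or_intror Hy)); lra.
Qed.

Lemma lsum_abs F l : Rabs (lsum F l) <= lsum (fun x => Rabs (F x)) l.
Proof.
elim: l => [|x l IH] /=; first by rewrite Rabs_R0; lra.
have := Rabs_triang (F x) (lsum F l); lra.
Qed.
End ListSums.

Lemma lsum_map X Y (F : Y -> R) (h : X -> Y) l : lsum F (map h l) = lsum (fun x => F (h x)) l.
Proof. by elim: l => //= x l ->. Qed.

Section Bernstein.
Variables a b : R.
Hypothesis ab : a < b.

Let up := (- a / (b - a)) :: (/ (b - a)) :: nil.
Let down := (b / (b - a)) :: (- / (b - a)) :: nil.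
Let u t := (t - a) / (b - a).

Lemma reval_up t : reval up t = u t.
Proof. rewrite /reval /up /u /=; field; lra. Qed.

Lemma reval_down t : reval down t = 1 - u t.
Proof. rewrite /reval /down /u /=; field; lra. Qed.

(* The pairs (number of successes, probability) of [n] independent trials with
   success probability [u t]; outcomes are not grouped, so there are [2 ^ n]. *)
Fixpoint trials (n : nat) : list (R * list R) :=
  match n with
  | O => (0, 1 :: nil) :: nil
  | S n => map (fun kp => (fst kp + 1, pmul up (snd kp))) (trials n) ++
           map (fun kp => (fst kp, pmul down (snd kp))) (trials n)
  end.

Lemma trials_range n kp : In kp (trials n) -> 0 <= fst kp <= INR n /\
  forall t, a <= t <= b -> 0 <= reval (snd kp) t.
Proof.
elim: n kp => [|n IH] kp.
  by move=> [<-|[]] /=; split; [lra | move=> t _; lra].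
have Hu t : a <= t <= b -> 0 <= u t <= 1.
  move=> Ht; have P : 0 < / (b - a) by apply: Rinv_0_lt_compat; lra.
  have E : u t + (b - t) * / (b - a) = 1 by rewrite /u; field; lra.
  have : 0 <= (b - t) * / (b - a) by apply: Rmult_le_pos; lra.
  by split; [apply: Rmult_le_pos; lra | lra].
change (In kp (trials (S n))) with (In kp
  (map (fun kp => (fst kp + 1, pmul up (snd kp))) (trials n) ++
   map (fun kp => (fst kp, pmul down (snd kp))) (trials n))).
rewrite S_INR in_app_iff !in_map_iff => -[] [[k p] [<- Hkp]]; cbn [fst snd];
  have [Hk Hp] := IH _ Hkp; cbn [fst snd] in Hk, Hp.
- split; first lra.
  by move=> t Ht; rewrite reval_pmul reval_up; apply: Rmult_le_pos; [have := Hu t Ht; lra | exact: Hp].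
- split; first lra.
  by move=> t Ht; rewrite reval_pmul reval_down; apply: Rmult_le_pos; [have := Hu t Ht; lra | exact: Hp].
Qed.

(** The expectation of [F] at the number of successes. *)
Let E t n (F : R -> R) := lsum (fun kp => F (fst kp) * reval (snd kp) t) (trials n).

Let E_S t n F : E t (S n) F = u t * E t n (fun k => F (k + 1)) + (1 - u t) * E t n F.
Proof.
rewrite /E; cbn [trials]; rewrite lsum_app !lsum_map -!lsum_scale; congr (_ + _); apply: lsum_ext => kp;
  cbn [fst snd]; rewrite reval_pmul ?reval_up ?reval_down; ring.
Qed.

Let E_lin t n c d e F G H : E t n (fun k => c * F k + d * G k + e * H k) =
  c * E t n F + d * E t n G + e * E t n H.
Proof.
rewrite /E -!lsum_scale -!lsum_add; apply: lsum_ext => kp; ring.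
Qed.

Lemma trials_moments t n :
  E t n (fun _ => 1) = 1 /\ E t n (fun k => k) = INR n * u t /\
  E t n (fun k => k * k) = INR n * INR n * (u t * u t) + INR n * (u t * (1 - u t)).
Proof.
elim: n => [|n [I0 [I1 I2]]]; first by rewrite /E /=; split; [|split]; ring.
have J1 : E t n (fun k => k + 1) = INR n * u t + 1.
  have := E_lin t n 1 1 0 (fun k => k) (fun _ => 1) (fun _ => 1).
  rewrite I0 I1 => H; transitivity (1 * (INR n * u t) + 1 * 1 + 0 * 1); last ring.
  by rewrite -H; apply: lsum_ext => kp; ring.
have J2 : E t n (fun k => (k + 1) * (k + 1)) = E t n (fun k => k * k) + 2 * (INR n * u t) + 1.
  have := E_lin t n 1 2 1 (fun k => k * k) (fun k => k) (fun _ => 1).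
  rewrite I0 I1 => H; transitivity (1 * E t n (fun k => k * k) + 2 * (INR n * u t) + 1 * 1); last ring.
  by rewrite -H; apply: lsum_ext => kp; ring.
by rewrite !E_S J1 J2 I0 I1 I2 S_INR; split; [|split]; ring.
Qed.

(** Mass, mean and second moment of the binomial law carried to the nodes [a + (b - a) * k / N]; the
    excess over [t * t] is its variance. Taking [N = n + 1] trials avoids division by 0. *)
Lemma bernstein_partition n : exists l : list (R * list R),
  (forall s p, In (s, p) l -> a <= s <= b /\ forall t, a <= t <= b -> 0 <= reval p t) /\
  (forall t, lsum (fun sp => reval (snd sp) t) l = 1 /\
     lsum (fun sp => fst sp * reval (snd sp) t) l = t /\
     lsum (fun sp => fst sp * fst sp * reval (snd sp) t) l =
       t * t + (t - a) * (b - t) / INR (S n)).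
Proof.
set N := INR (S n); have N0 : 0 < N by apply: lt_0_INR; lia.
pose node k := a + (b - a) * k / N.
exists (map (fun kp => (node (fst kp), snd kp)) (trials (S n))); split.
  move=> s p; rewrite in_map_iff => -[[k q] [[<- <-] /trials_range [Hk Hq]]]; split=> //.
  cbn [fst] in Hk |- *; rewrite -/N in Hk.
  have : 0 <= k / N <= 1.
    split; first by apply: Rmult_le_pos; [lra | apply: Rlt_le; exact: Rinv_0_lt_compat].
    by apply: (Rmult_le_reg_r N) => //; rewrite /Rdiv Rmult_assoc Rinv_l; lra.
  by rewrite /node /Rdiv Rmult_assoc; nra.
move=> t; have [M0 [M1 M2]] := trials_moments t (S n); rewrite -/N in M1 M2.
rewrite !lsum_map /=; split; [|split].
- by rewrite -[RHS]M0; apply: lsum_ext => kp; ring.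
- have := E_lin t (S n) a ((b - a) / N) 0 (fun _ => 1) (fun k => k) (fun _ => 1).
  rewrite M0 M1 => H; transitivity (a * 1 + (b - a) / N * (N * u t) + 0 * 1).
    by rewrite -H; apply: lsum_ext => kp; rewrite /node /Rdiv; ring.
  by rewrite /u; field; lra.
- have := E_lin t (S n) (a * a) (2 * a * ((b - a) / N)) ((b - a) / N * ((b - a) / N))
    (fun _ => 1) (fun k => k) (fun k => k * k).
  rewrite M0 M1 M2 => H.
  transitivity (a * a * 1 + 2 * a * ((b - a) / N) * (N * u t) +
    (b - a) / N * ((b - a) / N) * (N * N * (u t * u t) + N * (u t * (1 - u t)))).
    by rewrite -H; apply: lsum_ext => kp; rewrite /node /Rdiv; ring.
  by rewrite /u; field; lra.
Qed.

End Bernstein.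

(** Composition with the retraction of the line onto the interval, which is 1-Lipschitz, gives the
    pointwise continuity that Heine's theorem asks for. *)
Lemma cont_on_extend a b f : a <= b -> cont_on (fun t => a <= t <= b) f ->
  exists h, (forall t, a <= t <= b -> h t = f t) /\ forall t, continuity_pt h t.
Proof.
move=> ab Hf; pose c t := Rmax a (Rmin b t).
have Hc t : a <= c t <= b by rewrite /c /Rmax /Rmin; do 2 case: Rle_dec; lra.
have Lc s t : Rabs (c s - c t) <= Rabs (s - t).
  apply: (Rle_trans _ (Rabs (Rmin b s - Rmin b t))).
    by rewrite /c /Rmax /Rabs; do 2 case: Rle_dec => ?; repeat (case: Rcase_abs => ?); lra.
  by rewrite /Rmin /Rabs; do 2 case: Rle_dec => ?; repeat (case: Rcase_abs => ?); lra.
exists (fun t => f (c t)); split.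
  by move=> t Ht; congr f; rewrite /c /Rmax /Rmin; do 2 case: Rle_dec; lra.
move=> t e He; have [d [Hd H]] := Hf _ (Hc t) e He.
exists d; split=> // s [_ Hs]; apply: H => //.
exact: Rle_lt_trans (Lc s t) Hs.
Qed.

Lemma Weierstrass a b f : cont_on (fun t => a <= t <= b) f -> forall e, 0 < e ->
  exists p, forall t, a <= t <= b -> Rabs (f t - reval p t) <= e.
Proof.
move=> Hf e He.
case: (Rlt_le_dec a b) => ab; last first.
  exists (f a :: nil) => t Ht; have -> : t = a by lra.
  by rewrite /= Rmult_0_r Rplus_0_r Rminus_diag Rabs_R0; lra.
have [h [Eh Ch]] := cont_on_extend (Rlt_le _ _ ab) Hf.
have [d Hd] := Heine h _ (compact_P3 a b) (fun t _ => Ch t) (mkposreal (e / 2) ltac:(lra)).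
have [x1 [Hx1 _]] := continuity_ab_maj h a b (Rlt_le _ _ ab) (fun t _ => Ch t).
have [x2 [Hx2 _]] := continuity_ab_min h a b (Rlt_le _ _ ab) (fun t _ => Ch t).
pose M := h x1 - h x2.
have d0 := cond_pos d.
have M0 : 0 <= M by have := Hx1 a ltac:(lra); have := Hx2 a ltac:(lra); rewrite /M; lra.
pose K := M / (d * d).
have dd : 0 < d * d by apply: Rmult_lt_0_compat.
have K0 : 0 <= K by apply: Rmult_le_pos => //; apply: Rlt_le; apply: Rinv_0_lt_compat.
(* Chebyshev's argument: uniform continuity settles nodes near [t]; for the others the oscillation
   [M] is at most [K] times the squared distance, whose mean is the variance. *)
have Hfs s t : a <= s <= b -> a <= t <= b -> Rabs (h t - h s) <= e / 2 + K * ((s - t) * (s - t)).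
  move=> Hs Ht; have Q : 0 <= (s - t) * (s - t) := Rle_0_sqr (s - t).
  case: (Rlt_le_dec (Rabs (t - s)) d) => Hts.
    have := Hd t s Ht Hs Hts; rewrite /=; have := Rmult_le_pos _ _ K0 Q; lra.
  have : Rabs (h t - h s) <= M.
    apply: Rabs_le; rewrite /M.
    have := Hx1 t Ht; have := Hx1 s Hs; have := Hx2 t Ht; have := Hx2 s Hs; lra.
  have D : d * d <= (s - t) * (s - t).
    have -> : (s - t) * (s - t) = Rabs (t - s) * Rabs (t - s).
      by rewrite -Rabs_mult Rabs_right //; [ring | apply: Rle_ge; exact: (Rle_0_sqr (t - s))].
    by apply: Rmult_le_compat; lra.
  have : M = K * (d * d) by rewrite /K; field; lra.
  have := Rmult_le_compat_l K _ _ K0 D; lra.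
have [n Hn] : exists n, K * ((b - a) * (b - a)) / INR (S n) <= e / 2.
  have [n [Hn n0]] := archimed_cor1 (e / 2 / (K * ((b - a) * (b - a)) + 1))
    ltac:(apply: Rdiv_lt_0_compat; [lra | have := Rle_0_sqr (b - a); rewrite /Rsqr; nra]).
  have C0 : 0 <= K * ((b - a) * (b - a)).
    by apply: Rmult_le_pos => //; exact: (Rle_0_sqr (b - a)).
  exists n.
  have : / INR (S n) <= e / 2 / (K * ((b - a) * (b - a)) + 1).
    apply: Rle_trans (Rlt_le _ _ Hn); apply: Rinv_le_contravar; last by rewrite S_INR; lra.
    exact: lt_0_INR.
  move=> H.
  have -> : e / 2 = (e / 2 / (K * ((b - a) * (b - a)) + 1)) * (K * ((b - a) * (b - a)) + 1) by field; lra.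
  have P : 0 < / INR (S n) by apply: Rinv_0_lt_compat; apply: lt_0_INR; lia.
  rewrite /Rdiv in H *; nra.
have [l [Hl Ml]] := bernstein_partition ab n.
pose P := fold_right (fun sp acc => padd (map (Rmult (h (fst sp))) (snd sp)) acc) nil l.
exists P => t Ht; rewrite -Eh //.
have [L0 [L1 L2]] := Ml t.
have -> : reval P t = lsum (fun sp => h (fst sp) * reval (snd sp) t) l.
  rewrite /P; elim: (l) => //= sp l' IH.
  by rewrite reval_padd reval_pscale IH.
have -> : h t - lsum (fun sp => h (fst sp) * reval (snd sp) t) l =
  lsum (fun sp => (h t - h (fst sp)) * reval (snd sp) t) l.
  transitivity (h t * lsum (fun sp => reval (snd sp) t) l +
    (Ropp 1) * lsum (fun sp => h (fst sp) * reval (snd sp) t) l); first by rewrite L0; ring.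
  by rewrite -!lsum_scale -lsum_add; apply: lsum_ext => sp; ring.
apply: Rle_trans (lsum_abs _ _) _.
apply: (Rle_trans _ (lsum (fun sp => (e / 2 + K * ((fst sp - t) * (fst sp - t))) * reval (snd sp) t) l)).
  apply: lsum_le => -[s p] Hsp /=; have [Hs Hp] := Hl s p Hsp.
  rewrite Rabs_mult (Rabs_right (reval p t)); last by apply: Rle_ge; exact: Hp.
  by apply: Rmult_le_compat_r; [exact: Hp | exact: Hfs].
have -> : lsum (fun sp => (e / 2 + K * ((fst sp - t) * (fst sp - t))) * reval (snd sp) t) l =
  e / 2 + K * ((t - a) * (b - t) / INR (S n)).
  transitivity ((e / 2 + K * (t * t)) * lsum (fun sp => reval (snd sp) t) l +
    (- 2 * K * t) * lsum (fun sp => fst sp * reval (snd sp) t) l +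
    K * lsum (fun sp => fst sp * fst sp * reval (snd sp) t) l); last by rewrite L0 L1 L2; field; apply: not_0_INR.
  by rewrite -!lsum_scale -!lsum_add; apply: lsum_ext => sp; ring.
have P0 : 0 < / INR (S n) by apply: Rinv_0_lt_compat; apply: lt_0_INR; lia.
have : (t - a) * (b - t) <= (b - a) * (b - a) by nra.
move=> H; have := Rmult_le_compat_l (K * / INR (S n)) _ _ ltac:(apply: Rmult_le_pos; lra) H.
rewrite /Rdiv in Hn *; lra.
Qed.

Lemma cont_on_sqrt M : cont_on (fun t => 0 <= t <= M) sqrt.
Proof.
(* With [u] and [v] the two roots, [(u - v)^2 <= |u - v| (u + v) = |s - t|]. *)
move=> t [Ht _] e He; exists (e * e); split; first nra.
move=> s [Hs _] Hst.
have Qs := sqrt_pos s; have Qt := sqrt_pos t.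
have Es := sqrt_sqrt s Hs; have Et := sqrt_sqrt t Ht.
set u := sqrt s in Qs Es *; set v := sqrt t in Qt Et *.
have Hm : Rabs (u - v) * Rabs (u + v) = Rabs (s - t).
  by rewrite -Rabs_mult -Es -Et; congr Rabs; ring.
have Hl : Rabs (u - v) <= Rabs (u + v).
  by rewrite (Rabs_right (u + v)); [apply: Rabs_le; lra | lra].
have := Rabs_pos (u - v); nra.
Qed.

Section Existence.
Context {A : CStarAlg}.
Implicit Types (x y : A) (f g : R -> R).

Lemma fc_exists x a b f : self_adjoint x -> (forall t, specR x t -> a <= t <= b) ->
  cont_on (fun t => a <= t <= b) f -> exists y, is_fcalc x f y.
Proof.
move=> Hx Hab Hf.
have [p Hp] : exists p : nat -> list R, forall n t, a <= t <= b ->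
    Rabs (f t - reval (p n) t) <= / INR (S n).
  exists (fun n => epsilon (inhabits nil) (fun p => forall t, a <= t <= b ->
    Rabs (f t - reval p t) <= / INR (S n))) => n.
  apply: (epsilon_spec (inhabits nil) (fun p => forall t, a <= t <= b ->
    Rabs (f t - reval p t) <= / INR (S n))).
  by apply: Weierstrass => //; apply: Rinv_0_lt_compat; apply: lt_0_INR; lia.
have inv_le m n : (m <= n)%nat -> / INR (S n) <= / INR (S m).
  by move=> H; apply: Rinv_le_contravar; [apply: lt_0_INR; lia | apply: le_INR; lia].
have small e : 0 < e -> exists N, / INR (S N) < e.
  move=> He; have [n [Hn n0]] := archimed_cor1 e He.
  exists n; apply: Rle_lt_trans Hn; apply: Rinv_le_contravar; last by rewrite S_INR; lra.
  exact: lt_0_INR.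
have D m n N : (N <= m)%nat -> (N <= n)%nat ->
    nrm (peval (p m) x - peval (p n) x) <= 2 * / INR (S N).
  move=> Hm Hn.
  have -> : (peval (p m) x - peval (p n) x)%A = peval (padd (p m) (map (Rmult (Ropp 1)) (p n))) x.
    by rewrite peval_padd peval_pscale -oppE.
  have P : 0 < / INR (S N) by apply: Rinv_0_lt_compat; apply: lt_0_INR; lia.
  apply: peval_norm_le => //; first lra.
  move=> t /Hab Ht; rewrite reval_padd reval_pscale.
  have H1 := Hp m t Ht; have H2 := Hp n t Ht.
  have := inv_le _ _ Hm; have := inv_le _ _ Hn.
  have := Rabs_triang (f t - reval (p n) t) (- (f t - reval (p m) t)); rewrite Rabs_Ropp.
  have -> : f t - reval (p n) t + - (f t - reval (p m) t) = reval (p m) t + Ropp 1 * reval (p n) t by ring.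
  lra.
have [e He|y Hy] := complete A (fun n => peval (p n) x).
  have [N HN] := small (e / 2) ltac:(lra); exists N => m n Hm Hn.
  have := D m n N Hm Hn; rewrite /sub; lra.
exists y => e He.
have [N1 H1] := Hy e He; have [N2 H2] := small e He.
pose n := Nat.max N1 N2; exists (p n); split.
  move=> t /Hab Ht; rewrite -/(reval _ _).
  apply: Rle_trans (Hp n t Ht) _; apply: Rlt_le; apply: Rle_lt_trans H2.
  by apply: inv_le; rewrite /n; lia.
by rewrite norm_subC; apply: Rlt_le; apply: H1; rewrite /n; lia.
Qed.

Lemma fcalcP x f : (exists y, is_fcalc x f y) -> is_fcalc x f (fcalc x f).
Proof. by move=> H; exact: epsilon_spec. Qed.

Lemma fcalcE x f y : self_adjoint x -> is_fcalc x f y -> fcalc x f = y.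
Proof.
move=> Hx H; apply: (fc_unique Hx (f := f)) => //.
by apply: fcalcP; exists y.
Qed.
End Existence.

(** * The positive cone *)

Section Positivity.
Context {A : CStarAlg}.
Implicit Types (x y z w : A) (r s t : R).

Lemma pos_sa x : positive x -> self_adjoint x. Proof. by case. Qed.

Lemma pos_specR x t : positive x -> specR x t -> 0 <= t.
Proof. by case=> _ H /H []. Qed.

Lemma invertibleN x : invertible x -> invertible (- x)%A.
Proof. by move=> H; rewrite oppE; apply: invertible_smul => //; case; lra. Qed.

(** With [pos_norm], this is the norm criterion for positivity: it replaces the spectrum by a
    condition that passes to sums and limits through the triangle inequality. *)
Lemma pos_of_norm x s : self_adjoint x -> nrm (s .* 1 - x) <= s -> positive x.
Proof.
move=> Hx Hs; split=> // z Hz; have Iz := sa_spec_real Hx Hz; split=> //.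
apply: Rnot_lt_le => Hlt; apply: Hz.
have -> : z = RtoC (re z) by apply: Cplx_ext.
have -> : (x - RtoC (re z) *: 1)%A = (- ((s .* 1 - x) - (s - re z) .* 1))%A.
  rewrite (_ : s - re z = s + - re z) // rscDl rscN /rsc; nc.
apply: invertibleN; apply: norm_lt_invertible; rewrite Rabs_right; first lra.
have := norm_ge0 A (s .* 1 - x)%A; lra.
Qed.

Lemma pos_norm x s : positive x -> nrm x <= s -> nrm (s .* 1 - x) <= s.
Proof.
move=> Hx Hs; have N0 := norm_ge0 A x.
apply: sa_norm_le_spec; [|lra|].
  by apply: saB (pos_sa Hx); apply: sa_rsc; exact: sa1.
move=> t Ht.
have Ht' : specR x (s - t).
  move=> Hi; apply: Ht; rewrite -/(rsc t _).
  have -> : (s .* 1 - x - t .* 1)%A = (- (x - (s - t) .* 1))%A.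
    rewrite (_ : s - t = s + - t) // rscDl rscN; nc.
  exact: invertibleN.
have := specR_le_norm Ht'; have := pos_specR Hx Ht' => H1.
rewrite Rabs_right; last lra.
move=> H2; rewrite Rabs_right; lra.
Qed.

Lemma posD x y : positive x -> positive y -> positive (x + y)%A.
Proof.
move=> Hx Hy; apply: (@pos_of_norm _ (nrm x + nrm y)).
  by apply: saD; exact: pos_sa.
have -> : ((nrm x + nrm y) .* 1 - (x + y))%A =
  ((nrm x .* 1 - x) + (nrm y .* 1 - y))%A by rewrite rscDl; nc.
have := pos_norm Hx (Rle_refl _); have := pos_norm Hy (Rle_refl _).
have := norm_triangle A (nrm x .* 1 - x)%A (nrm y .* 1 - y)%A; lra.
Qed.

Lemma pos_rsc r x : 0 <= r -> positive x -> positive (r .* x)%A.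
Proof.
move=> Hr Hx; apply: (@pos_of_norm _ (r * nrm x)).
  by apply: sa_rsc; exact: pos_sa.
rewrite -rscA -rscB norm_rsc Rabs_right; last lra.
by apply: Rmult_le_compat_l => //; apply: pos_norm => //; lra.
Qed.

Lemma pos0 : positive (0%A : A).
Proof.
apply: (@pos_of_norm _ 0); first exact: sa0.
by rewrite rsc0 (_ : (0 - 0)%A = 0%A) ?norm0; [lra | nc].
Qed.

Lemma pos_limit x : (forall e, 0 < e -> exists y, positive y /\ nrm (x - y) <= e) ->
  positive x.
Proof.
move=> H; apply: (@pos_of_norm _ (nrm x + 1)).
  apply: sub_eq0; apply: norm_small => e He.
  have [y [Hy Ny]] := H (e / 2) ltac:(lra).
  have -> : (x^* - x)%A = ((x - y)^* - (x - y))%A by rewrite starB (pos_sa Hy); nc.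
  have := norm_triangle_sub (x - y)^*%A (x - y)%A; rewrite norm_star; lra.
apply: le_epsilon => e He.
have [y [Hy Ny]] := H (Rmin e 1) (Rmin_pos _ _ He Rlt_0_1).
have M1 := Rmin_l e 1; have M2 := Rmin_r e 1.
have := norm_le_sub y x; rewrite norm_subC => Hn.
have := @pos_norm y (nrm x + 1) Hy ltac:(lra).
have := norm_sub_le ((nrm x + 1) .* 1)%A y x; rewrite (norm_subC y x); lra.
Qed.

Lemma pos_eps x w : (forall e, 0 < e -> positive (x + e .* w)%A) -> positive x.
Proof.
move=> H; apply: pos_limit => e He.
have Nw := norm_ge0 A w.
pose d := e / (nrm w + 1).
have Hd : 0 < d by apply: Rdiv_lt_0_compat; lra.
exists (x + d .* w)%A; split; first exact: H.
have -> : (x - (x + d .* w))%A = (- (d .* w))%A by nc.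
rewrite normN norm_rsc Rabs_right; last lra.
have : d * (nrm w + 1) = e by rewrite /d; field; lra.
nra.
Qed.

Section OneElement.
Variable x : A.
Hypothesis Hx : self_adjoint x.
Implicit Types f : R -> R.

Lemma fc_pos f y : is_fcalc x f y -> (forall t, specR x t -> 0 <= f t) -> positive y.
Proof.
move=> Hf Hp; apply: (@pos_of_norm _ (nrm y)); first exact: (fc_sa Hx Hf).
apply: (fc_norm_le Hx (norm_ge0 A y) (fc_sub (fc_const x (nrm y)) Hf)) => t Ht.
have := fc_bound Hf Ht; have := Hp t Ht => H0.
by rewrite Rabs_right; last lra; move=> H1; rewrite Rabs_right; lra.
Qed.

Lemma sa_sqr_pos : positive (x * x)%A.
Proof.
by apply: (fc_pos (fc_mul (fc_id x) (fc_id x))) => t _; exact: Rle_0_sqr.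
Qed.

Lemma specR_interval t : specR x t -> - nrm x <= t <= nrm x.
Proof. by move=> Ht; have := specR_le_norm Ht; rewrite /Rabs; case: Rcase_abs; lra. Qed.

End OneElement.

Lemma pos_specR_interval x t : positive x -> specR x t -> 0 <= t <= nrm x.
Proof.
move=> H Ht; split; first exact: pos_specR H Ht.
by have := specR_interval Ht; lra.
Qed.

Lemma pos_sqrt x : positive x -> exists w, is_fcalc x sqrt w /\ positive w /\ (w * w)%A = x.
Proof.
move=> Hp; have Hx := pos_sa Hp.
have [w Hw] := fc_exists Hx (fun t => @pos_specR_interval x t Hp) (@cont_on_sqrt (nrm x)).
exists w; split=> //; split.
  by apply: (fc_pos Hx Hw) => t _; exact: sqrt_pos.
apply: (fc_unique Hx (fc_mul Hw Hw)).
apply: fc_ext (fc_id x) => t Ht; rewrite sqrt_sqrt //; exact: pos_specR Hp Ht.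
Qed.

(** Jacobson's identity: if [z] inverts [y x - t], then [(x z y - 1) / t] inverts [x y - t]. *)
Lemma specR_mulC x y t : t <> 0 -> specR (x * y)%A t -> specR (y * x)%A t.
Proof.
move=> Ht H [z [H1 H2]]; apply: H; rewrite -/(rsc t _) in H1 H2 *.
exists (/ t .* (x * z * y - 1))%A.
have E1 : (y * x * z)%A = (1 + t .* z)%A.
  by rewrite -H1 -[in X in (_ + X)%A](mul1l _ z) rscMl; nc.
have E2 : (z * (y * x))%A = (1 + t .* z)%A.
  by rewrite -H2 -[in X in (_ + X)%A](mul1r _ z) rscMr; nc.
have Et : (/ t .* (t .* 1))%A = 1%A :> A by rewrite rscA Rinv_l // rsc1.
split; rewrite -?rscMr -?rscMl -[RHS]Et; congr rsc.
- have -> : ((x * y - t .* 1) * (x * z * y - 1))%A =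
    (x * (y * x * z) * y - x * y + t .* 1 - (t .* 1) * (x * z * y))%A by nc.
  rewrite E1 -rscMl mul1l.
  have -> : (x * (1 + t .* z) * y)%A = (x * y + t .* (x * z * y))%A.
    by rewrite rscMl rscMr; nc.
  nc.
- have -> : ((x * z * y - 1) * (x * y - t .* 1))%A =
    (x * (z * (y * x)) * y - x * y + t .* 1 - (x * z * y) * (t .* 1))%A by nc.
  rewrite E2 -rscMr mul1r.
  have -> : (x * (1 + t .* z) * y)%A = (x * y + t .* (x * z * y))%A.
    by rewrite rscMl rscMr; nc.
  nc.
Qed.

Definition re_part x : A := (/ 2 .* (x + x^* ))%A.
Definition im_part x : A := (/ 2 .* (Ci *: (x^* - x)))%A.

Lemma re_part_sa x : self_adjoint (re_part x).
Proof.
apply: sa_rsc; rewrite /self_adjoint starD starK; nc.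
Qed.

Lemma im_part_sa x : self_adjoint (im_part x).
Proof.
apply: sa_rsc; rewrite /self_adjoint star_Ci starB starK -smulN; congr smul; nc.
Qed.

Lemma re_im x : x = (re_part x + Ci *: im_part x)%A.
Proof.
rewrite /re_part /im_part -rsc_Ci CiCi -rscDr.
by rewrite (_ : (x + x^* + - (x^* - x))%A = (x + x)%A) ?rsc_half //; nc.
Qed.

Lemma star_cartesian (a b : A) : self_adjoint a -> self_adjoint b ->
  ((a + Ci *: b)^* )%A = (a - Ci *: b)%A.
Proof. by move=> Ha Hb; rewrite starD star_Ci Ha Hb. Qed.

Lemma starM_cartesian x :
  (x^* * x + x * x^* )%A = ((1 + 1) * (re_part x * re_part x + im_part x * im_part x))%A.
Proof.
have Ha := re_part_sa x; have Hb := im_part_sa x.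
rewrite {1 2 3 4}(re_im x); set a := re_part x; set b := im_part x.
rewrite star_cartesian //.
have -> : ((a - Ci *: b) * (a + Ci *: b) + (a + Ci *: b) * (a - Ci *: b))%A =
  (a * a + a * a - (Ci *: b * (Ci *: b) + Ci *: b * (Ci *: b)))%A by nc.
rewrite -smulMl -smulMr CiCi; nc.
Qed.

(* Kaplansky: with [m] the negative part of [x^* x] and [z = x m], the element
   [z^* z] is negative; as [z z^* + z^* z] is positive, [z z^*] is positive, and it
   has the same nonzero spectrum as [z^* z], which therefore vanishes. *)
Lemma starM_pos x : positive (x^* * x)%A.
Proof.
set y := (x^* * x)%A; have Hy : self_adjoint y := sa_starM x.
pose q t := Rmax 0 (- t).
have Cq : cont_on (fun t => - nrm y <= t <= nrm y) q.
  move=> t _ e He; exists e; split=> // s _.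
  by rewrite /q /Rmax; do 2 case: Rle_dec => ?; rewrite /Rabs; repeat (case: Rcase_abs => ?); lra.
have [m Hm] := fc_exists Hy (@specR_interval y) Cq.
have Sm := fc_sa Hy Hm.
pose z := (x * m)%A.
have Ez : (z^* * z)%A = (m * y * m)%A by rewrite /z /y starM Sm; nc.
have Hz : is_fcalc y (fun t => q t * t * q t) (z^* * z)%A.
  by rewrite Ez; exact: fc_mul (fc_mul Hm (fc_id y)) Hm.
have Nz : positive (- (z^* * z))%A.
  rewrite oppE; apply: (fc_pos Hy (fc_scale (Ropp 1) Hz)) => t _.
  by rewrite /q /Rmax; case: Rle_dec => ?; nra.
have Pz : positive (z * z^* )%A.
  have -> : (z * z^* )%A = ((z^* * z + z * z^* ) + - (z^* * z))%A by nc.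
  apply: posD => //; rewrite starM_cartesian.
  have P := posD (sa_sqr_pos (re_part_sa z)) (sa_sqr_pos (im_part_sa z)).
  set w := (_ + im_part z * _)%A in P *.
  by rewrite (_ : ((1 + 1) * w)%A = (w + w)%A); [exact: posD | nc].
have Z0 : (z^* * z)%A = 0%A.
  apply: norm_eq0; apply: Rle_antisym (norm_ge0 _ _).
  apply: sa_norm_le_spec; [exact: sa_starM | lra |] => t Ht.
  case: (Req_dec t 0) => [->|T0]; first by rewrite Rabs_R0; lra.
  have T1 := pos_specR Pz (@specR_mulC _ _ _ T0 Ht).
  suff : 0 <= - t by move=> T2; rewrite Rabs_right; lra.
  apply: (pos_specR Nz) => Hi; apply: Ht.
  have -> : (z^* * z - RtoC t *: 1)%A = (- (- (z^* * z) - RtoC (- t) *: 1))%A.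
    rewrite -!/(rsc _ _) rscN; nc.
  exact: invertibleN.
split=> // u Hu; have Iu := sa_spec_real Hy Hu; split=> //.
have Hu' : specR y (re u).
  by move: Hu; rewrite /specR (_ : u = RtoC (re u)) //; apply: Cplx_ext.
(* The function [q t * t * q t] equals [t^3] for negative [t], so its vanishing on the spectrum
   excludes negative points. *)
have := fc_bound Hz Hu'; rewrite Z0 norm0 => B.
apply: Rnot_lt_le => Hlt.
have E : q (re u) = - re u by rewrite /q Rmax_right //; lra.
rewrite E in B; have P : 0 < - re u * - re u * - re u.
  by apply: Rmult_lt_0_compat; [apply: Rmult_lt_0_compat|]; lra.
move: B; rewrite -Rabs_Ropp (_ : - (- re u * re u * - re u) = - re u * - re u * - re u); last ring.
rewrite Rabs_right; lra.
Qed.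

Lemma pos_conj x c : positive x -> positive (c^* * x * c)%A.
Proof.
move=> Hx; have [w [_ [Hw <-]]] := pos_sqrt Hx.
have -> : (c^* * (w * w) * c)%A = ((w * c)^* * (w * c))%A.
  rewrite starM (pos_sa Hw); nc.
exact: starM_pos.
Qed.

End Positivity.

(** * Positive linear maps and the involution *)

Section PositiveMaps.
Context {A B : CStarAlg}.
Variable Phi : A -> B.
Hypothesis Hlin : linear_map Phi.
Hypothesis Hpos : positive_map Phi.
Implicit Types (x y : A) (r : R).

Lemma mapD x y : Phi (x + y)%A = (Phi x + Phi y)%A. Proof. exact: (proj1 Hlin). Qed.
Lemma mapZ c x : Phi (c *: x)%A = (c *: Phi x)%A. Proof. exact: (proj2 Hlin). Qed.
Lemma map_rsc r x : Phi (r .* x)%A = (r .* Phi x)%A. Proof. exact: mapZ. Qed.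
Lemma mapN x : Phi (- x)%A = (- Phi x)%A. Proof. by rewrite !oppE map_rsc. Qed.
Lemma mapB x y : Phi (x - y)%A = (Phi x - Phi y)%A. Proof. by rewrite subE mapD mapN. Qed.
Lemma map0 : Phi 0%A = 0%A. Proof. by rewrite -(rsc0 0%A) map_rsc rsc0. Qed.

(** A self-adjoint [x] is the difference of the positive elements [nrm x .* 1] and
    [nrm x .* 1 - x]. *)
Lemma map_sa x : self_adjoint x -> self_adjoint (Phi x).
Proof.
move=> Hx; have N0 := norm_ge0 A x.
have -> : x = (nrm x .* 1 - (nrm x .* 1 - x))%A by nc.
rewrite mapB; apply: saB; apply: pos_sa; apply: Hpos.
  apply: pos_rsc => //; rewrite -[1%A]mul1l; exact: sa_sqr_pos sa1.
apply: (@pos_of_norm _ _ (nrm x)).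
  by apply: saB => //; apply: sa_rsc; exact: sa1.
have -> : (nrm x .* 1 - (nrm x .* 1 - x))%A = x by nc.
lra.
Qed.

Lemma map_star x : Phi (x^* )%A = ((Phi x)^* )%A.
Proof.
have Ha := re_part_sa x; have Hb := im_part_sa x.
rewrite [in LHS](re_im x) [in RHS](re_im x) star_cartesian // mapD mapB mapZ.
by rewrite star_cartesian //; exact: map_sa.
Qed.

End PositiveMaps.

(** * A Cauchy-Schwarz inequality for tracial positive maps *)

Lemma rsc1_mul (A : CStarAlg) r (x : A) : (r .* 1 * x)%A = (r .* x)%A.
Proof. by rewrite -rscMl mul1l. Qed.

Lemma mul_rsc1 (A : CStarAlg) r (x : A) : (x * (r .* 1))%A = (r .* x)%A.
Proof. by rewrite -rscMr mul1r. Qed.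

Section AlgebraSums.
Context {A : CStarAlg}.
Variable X : Type.
Implicit Types (F G : X -> A) (l : list X).

Definition asum F l : A := fold_right (fun x acc => (F x + acc)%A) 0%A l.

Lemma asum_add F G l : asum (fun x => F x + G x)%A l = (asum F l + asum G l)%A.
Proof. elim: l => [|x l IH] /=; rewrite ?IH; nc. Qed.

Lemma asum_pos F l : (forall x, In x l -> positive (F x)) -> positive (asum F l).
Proof.
elim: l => [|x l IH] /= H; first exact: pos0.
by apply: posD; [apply: H; left | apply: IH => y Hy; apply: H; right].
Qed.

Lemma fc_asum x (phi : X -> R -> R) F l : (forall i, is_fcalc x (phi i) (F i)) ->
  self_adjoint x -> is_fcalc x (fun t => lsum (fun i => phi i t) l) (asum F l).
Proof.
move=> H Hx; elim: l => [|i l IH] /=; last exact: fc_add.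
by have := fc_const x 0; rewrite rsc0.
Qed.
End AlgebraSums.

Lemma map_asum (A B : CStarAlg) (N : A -> B) X (F : X -> A) l : linear_map N ->
  N (asum F l) = asum (fun x => N (F x)) l.
Proof. by move=> H; elim: l => [|x l IH] /=; rewrite ?(map0 H) ?(mapD H) ?IH. Qed.

Section LinearMaps.
Context {A B : CStarAlg}.
Implicit Types (N M : A -> B) (c : B).

Lemma lin_mull c N : linear_map N -> linear_map (fun x => c * N x)%A.
Proof. by move=> H; split=> *; rewrite ?(mapD H) ?(mapZ H) ?mulDr ?smulMr. Qed.

Lemma lin_mulr c N : linear_map N -> linear_map (fun x => N x * c)%A.
Proof. by move=> H; split=> *; rewrite ?(mapD H) ?(mapZ H) ?mulDl ?smulMl. Qed.

Lemma lin_add N M : linear_map N -> linear_map M -> linear_map (fun x => N x + M x)%A.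
Proof. by move=> H H'; split=> *; rewrite ?(mapD H) ?(mapD H') ?(mapZ H) ?(mapZ H') ?smulDr //; nc. Qed.

Lemma lin_opp N : linear_map N -> linear_map (fun x => - N x)%A.
Proof. by move=> H; split=> *; rewrite ?(mapD H) ?(mapZ H) ?smulN //; nc. Qed.

Lemma lin_smul k N : linear_map N -> linear_map (fun x => k *: N x)%A.
Proof.
by move=> H; split=> *; rewrite ?(mapD H) ?(mapZ H) ?smulDr ?smulA //; congr smul; cplx.
Qed.

(* A quadratic polynomial in a real variable whose operator coefficients make it
   positive at every point stays positive when "integrated" against a self-adjoint
   [k]: sum the hypothesis over a Bernstein partition of unity evaluated at [k]. *)
Lemma quadratic_pos N0 N1 N2 k :
  linear_map N0 -> linear_map N1 -> linear_map N2 -> positive_map N2 ->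
  (forall V t, positive V -> positive (N0 V + t .* N1 V + (t * t) .* N2 V)%A) ->
  self_adjoint k -> positive (N0 1 + N1 k + N2 (k * k))%A.
Proof.
move=> L0 L1 L2 P2 H Hk; apply: (@pos_eps _ _ (N2 1%A)) => e He.
have Nk := norm_ge0 A k.
pose m := nrm k + 1.
have [n [Hn n0]] := archimed_cor1 (e / (4 * (m * m))) ltac:(apply: Rdiv_lt_0_compat; rewrite /m; nra).
have [l [Hl Ml]] := @bernstein_partition (- m) m ltac:(rewrite /m; lra) n.
have Hspec t : specR k t -> - m <= t <= m.
  by move=> Ht; have := specR_interval Ht; rewrite /m; lra.
pose U (sp : R * list R) := peval (snd sp) k.
have S0 : asum U l = 1%A.
  rewrite -[RHS]rsc1; apply: (fc_unique Hk _ (fc_const k 1)).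
  apply: fc_ext (fc_asum (fun sp => reval (snd sp)) U l (fun sp => fc_peval k (snd sp)) Hk) => t _.
  by have [-> _] := Ml t.
have S1 : asum (fun sp => fst sp .* U sp)%A l = k.
  apply: (fc_unique Hk _ (fc_id k)).
  apply: fc_ext (fc_asum _ _ l (fun sp : R * list R => fc_scale (fst sp) (fc_peval k (snd sp))) Hk) => t _.
  by have [_ [-> _]] := Ml t.
(* The Bernstein variance evaluated at [k]. The choice of [n] makes it at most [e], and the added
   term [e .* N2 1] absorbs it. *)
pose D := (asum (fun sp => (fst sp * fst sp) .* U sp) l - k * k)%A.
have HD : positive (e .* 1 - D)%A.
  have F2 := fc_asum _ _ l (fun sp : R * list R => fc_scale (fst sp * fst sp) (fc_peval k (snd sp))) Hk.
  apply: (fc_pos Hk (fc_sub (fc_const k e) (fc_sub F2 (fc_mul (fc_id k) (fc_id k))))) => t Ht.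
  have [_ [_ ->]] := Ml t; have Bt := Hspec t Ht.
  have Hn' : / INR (S n) <= e / (4 * (m * m)).
    apply: Rle_trans (Rlt_le _ _ Hn); apply: Rinv_le_contravar; last by rewrite S_INR; lra.
    exact: lt_0_INR.
  have P : 0 < / INR (S n) by apply: Rinv_0_lt_compat; apply: lt_0_INR; lia.
  have Q1 : 0 <= (t - - m) * (m - t) <= 4 * (m * m) by split; nra.
  have Q2 : (t - - m) * (m - t) * / INR (S n) <= (4 * (m * m)) * (e / (4 * (m * m))).
    by apply: Rmult_le_compat; lra.
  have Q3 : (4 * (m * m)) * (e / (4 * (m * m))) = e by field; rewrite /m; lra.
  rewrite /Rdiv in Q2 Q3 *; lra.
have -> : (N0 1 + N1 k + N2 (k * k) + e .* N2 1)%A =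
  (asum (fun sp => N0 (U sp) + fst sp .* N1 (U sp) + (fst sp * fst sp) .* N2 (U sp)) l
   + N2 (e .* 1 - D))%A.
  rewrite !asum_add.
  have -> : asum (fun sp => fst sp .* N1 (U sp))%A l = N1 k.
    rewrite -[in RHS]S1 map_asum //; elim: (l) => //= sp l' ->; by rewrite map_rsc //.
  have -> : asum (fun sp => (fst sp * fst sp) .* N2 (U sp))%A l = N2 (D + k * k)%A.
    have -> : (D + k * k)%A = asum (fun sp => (fst sp * fst sp) .* U sp)%A l by rewrite /D; nc.
    rewrite map_asum //; elim: (l) => //= sp l' ->; by rewrite map_rsc //.
  rewrite -map_asum // S0 (mapB L2) (mapD L2) (map_rsc L2); nc.
apply: posD; last exact: P2.
apply: asum_pos => -[s p] Hsp; apply: H.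
have [_ Hp] := Hl s p Hsp.
by apply: (fc_pos Hk (fc_peval k p)) => t Ht; apply: Hp; exact: Hspec.
Qed.

End LinearMaps.

(** * The Sylvester equation and the two-sided decomposition *)

Section Sylvester.
Context {A : CStarAlg}.
Implicit Types (T C X h k e r : A).

(** By [perturb], [T - u] stays invertible for [0 <= u < d], so the spectrum of [T] keeps distance
    [d] from 0. This gain over [pos_norm] is the contraction constant of [sylvester]. *)
Lemma pos_invertible_norm T : positive T -> invertible T ->
  exists s d, 0 < d <= s /\ nrm (s .* 1 - T) <= s - d.
Proof.
move=> HT [W HW]; have N0 := norm_ge0 A T; have NW := norm_ge0 A W.
pose d := / (2 * (nrm W + 1)).
have d0 : 0 < d by apply: Rinv_0_lt_compat; lra.
have Ed : (nrm W + 1) * d = / 2 by rewrite /d; field; lra.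
exists (nrm T + d), d; split; first lra.
apply: sa_norm_le_spec; [|lra|].
  by apply: saB (pos_sa HT); apply: sa_rsc; exact: sa1.
move=> t Ht.
have Hs : specR T (nrm T + d - t).
  move=> Hi; apply: Ht; rewrite -/(rsc t _).
  have -> : ((nrm T + d) .* 1 - T - t .* 1)%A = (- (T - (nrm T + d - t) .* 1))%A.
    rewrite (_ : nrm T + d - t = nrm T + d + - t) // !rscDl rscN; nc.
  exact: invertibleN.
have [P1 P2] := pos_specR_interval HT Hs.
have P3 : d <= nrm T + d - t.
  apply: Rnot_lt_le => Hlt; apply: Hs.
  have [|z [Hz _]] := @perturb _ T W ((nrm T + d - t) .* 1)%A HW; last by exists z.
  rewrite norm_rsc Rabs_right; last lra.
  have N1 := @norm1_le1 A; have N1' := norm_ge0 A 1%A.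
  have : (nrm T + d - t) * nrm (1%A : A) <= d * 1 by apply: Rmult_le_compat; lra.
  move=> L; have := Rmult_le_compat_l _ _ _ NW L; lra.
rewrite /Rabs; case: Rcase_abs; lra.
Qed.

(** Relaxation with step [/ (2 * s)]: a difference [u] of iterates goes to [(u S + S u) / (2 s)]
    with [S = s - T], of norm at most [(s - d) / s] times that of [u]. The real part of the solution
    solves the equation too, as [T] and [C] are self-adjoint. *)
Lemma sylvester T C : positive T -> invertible T -> self_adjoint C ->
  exists h, self_adjoint h /\ (h * T + T * h)%A = C.
Proof.
move=> HT IT HC; have [s [d [Hd Hs]]] := pos_invertible_norm HT IT.
pose S := (s .* 1 - T)%A.
have Pq : 0 < / (2 * s) by apply: Rinv_0_lt_compat; lra.
have [h Hh] : exists h, (h + / (2 * s) .* (C - (h * T + T * h)))%A = h.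
  apply: (@contraction _ (fun h => h + / (2 * s) .* (C - (h * T + T * h)))%A ((s - d) / s)).
    have : (s - d) / s = 1 - d * / s by field; lra.
    have : 0 < / s by apply: Rinv_0_lt_compat; lra.
    have : 0 <= (s - d) / s.
      by apply: Rmult_le_pos; [lra | apply: Rlt_le; apply: Rinv_0_lt_compat; lra].
    nra.
  move=> x y; set u := (x - y)%A.
  have -> : (x + / (2 * s) .* (C - (x * T + T * x)) - (y + / (2 * s) .* (C - (y * T + T * y))))%A
    = (/ (2 * s) .* (u * S + S * u))%A.
    have -> : (u * S + S * u)%A = ((2 * s) .* u - (u * T + T * u))%A.
      rewrite /S (_ : 2 * s = s + s); last ring.
      have -> : (u * (s .* 1 - T) + (s .* 1 - T) * u)%A =
        (u * (s .* 1) + s .* 1 * u - (u * T + T * u))%A by nc.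
      by rewrite -rscMr -rscMl mul1l mul1r rscDl.
    rewrite (rscB _ ((2 * s) .* u)%A) rscA Rinv_l ?rsc1; last lra.
    have -> : (u * T + T * u)%A = ((C - (y * T + T * y)) - (C - (x * T + T * x)))%A by rewrite /u; nc.
    move: (C - (y * T + T * y))%A (C - (x * T + T * x))%A => p q.
    rewrite (rscB _ p) /u; nc.
  rewrite norm_rsc Rabs_right; last lra.
  have H1 := norm_triangle A (u * S)%A (S * u)%A.
  have H2 := norm_subm A u S; have H3 := norm_subm A S u.
  have Nu := norm_ge0 A u.
  have H4 : nrm (u * S + S * u) <= 2 * ((s - d) * nrm u).
    have : nrm u * nrm S <= nrm u * (s - d) by exact: Rmult_le_compat_l.
    lra.
  have := Rmult_le_compat_l _ _ _ (Rlt_le _ _ Pq) H4.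
  have -> : / (2 * s) * (2 * ((s - d) * nrm u)) = (s - d) / s * nrm u by field; lra.
  done.
have E : (h * T + T * h)%A = C.
  apply: sub_eq0.
  have Z : (/ (2 * s) .* (C - (h * T + T * h)))%A = 0%A.
    have -> : (/ (2 * s) .* (C - (h * T + T * h)))%A =
      (h + / (2 * s) .* (C - (h * T + T * h)) - h)%A by nc.
    rewrite Hh; nc.
  have Z2 : (C - (h * T + T * h))%A = 0%A.
    by rewrite -[LHS](rsc_inv (r := 2 * s)) ?Z ?rscx0 //; lra.
  have -> : (h * T + T * h - C)%A = (- (C - (h * T + T * h)))%A by nc.
  rewrite Z2; nc.
exists (re_part h); split; first exact: re_part_sa.
rewrite /re_part -rscMl -rscMr -rscDr.
have -> : ((h + h^* ) * T + T * (h + h^* ))%A = ((h * T + T * h) + (h * T + T * h)^* )%A.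
  rewrite starD !starM (pos_sa HT); nc.
by rewrite E HC rsc_half.
Qed.

(** The equation for [h] says that [Y = X - h e] satisfies [Y e = - e Y^*]. Multiplying by the
    inverse [w] on both sides makes [w Y] skew-adjoint, so [k = - i w Y] is self-adjoint. *)
Lemma two_sided_decomposition e X : positive e -> invertible e ->
  exists h k, self_adjoint h /\ self_adjoint k /\ X = (h * e + Ci *: (e * k))%A.
Proof.
move=> He Ie; have Se := pos_sa He.
have [w Hw] := Ie; have [W1 W2] := Hw.
have Sw := inv_sa Se Hw.
have [||h [Sh Eh]] := @sylvester (e * e)%A (X * e + e * X^* )%A (sa_sqr_pos Se).
- exact: invertible_mul.
- rewrite /self_adjoint starD !starM starK Se; nc.
pose Y := (X - h * e)%A.
have EY : (Y * e)%A = (- (e * Y^* ))%A.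
  rewrite /Y starB starM Se Sh.
  have -> : ((X - h * e) * e)%A = (X * e + e * X^* - h * (e * e) - e * X^* )%A by nc.
  rewrite -Eh; nc.
have EY2 : (w * Y)%A = (- (Y^* * w))%A.
  have -> : (w * Y)%A = (w * (Y * e) * w)%A.
    have -> : (w * (Y * e) * w)%A = (w * Y * (e * w))%A by nc.
    by rewrite W1 mul1r.
  rewrite EY.
  have -> : (w * (- (e * Y^* )) * w)%A = (- ((w * e) * Y^* * w))%A by nc.
  by rewrite W2 mul1l.
exists h, (- (Ci *: (w * Y)))%A; split=> //; split.
  rewrite /self_adjoint starN star_Ci starM Sw EY2 smulN; nc.
have -> : (e * - (Ci *: (w * Y)))%A = (- (Ci *: (e * (w * Y))))%A.
  rewrite (smulMr A Ci e); nc.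
rewrite mulA W1 mul1l smulN CiCi /Y; nc.
Qed.
End Sylvester.

(** * The operator-valued Schwarz inequality *)

Section CauchySchwarz.
Context {A B : CStarAlg}.
Variable Phi : A -> B.
Hypothesis Hlin : linear_map Phi.
Hypothesis Hpos : positive_map Phi.
Hypothesis Htr : tracial Phi.
Implicit Types (x y u v h k e r : A).

Lemma trace_cycle u v x y : x = (u * v)%A -> y = (v * u)%A -> Phi x = Phi y.
Proof. by move=> -> ->; exact: Htr. Qed.

(** Writing [u = w w] and moving one [w] around the trace turns the argument into the conjugate of
    [v] by [e w]. *)
Lemma tracial_pair_pos e u v : self_adjoint e -> positive u -> positive v ->
  positive (Phi (u * e * v * e)%A).
Proof.
move=> Se Hu Hv; have [w [_ [Hw <-]]] := pos_sqrt Hu.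
rewrite (@trace_cycle w (w * e * v * e)%A _ ((e * w)^* * v * (e * w))%A); try nc.
  by apply: Hpos; exact: pos_conj.
rewrite starM Se (pos_sa Hw); nc.
Qed.

Lemma linear_comp_mul e u : linear_map (fun x => Phi (u * e * x * e)%A) /\
  linear_map (fun x => Phi (x * e * u * e)%A).
Proof.
split; split=> *; rewrite -?(mapD Hlin) -?(mapZ Hlin); congr Phi;
  rewrite ?mulDr ?mulDl -?smulMr -?smulMl //; congr smul; nc.
Qed.

(* Left multiplication by [h] and right multiplication by [k] commute, so
   [(U, V) |-> Phi (U e V e)] behaves like a measure on the product of the two
   spectra; [h e + i e k] plays the role of the coordinate function. *)
Lemma two_sided_schwarz e h k (b : B) :
  self_adjoint e -> self_adjoint h -> self_adjoint k ->
  let X := (h * e + Ci *: (e * k))%A in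
  positive (Phi (X^* * X) - Phi (X^* * e) * b - b^* * Phi (e * X)
            + b^* * Phi (e * e) * b)%A.
Proof.
move=> Se Sh Sk X.
pose G u v := Phi (u * e * v * e)%A.
have Lr u : linear_map (G u) by have [] := linear_comp_mul e u.
have Ll v : linear_map (fun u => G u v) by have [] := linear_comp_mul e v.
(* Integration over the spectrum of [h], with [V] and the value [t] for [k] fixed: for [c = b - i t]
   the integrand at [s] is [(c - s)^* (G U V) (c - s)]. *)
have inner V t : positive V ->
  let c := (b - t .* (Ci *: 1))%A in
  positive (c^* * G 1 V * c + (- (G h V * c + c^* * G h V)) + G (h * h) V)%A.
  move=> HV c.
  apply: (@quadratic_pos _ _ (fun u => c^* * G u V * c)%A
    (fun u => - (G u V * c + c^* * G u V))%A (fun u => G u V)) => //.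
  - by apply: lin_mulr; apply: lin_mull.
  - by apply: lin_opp; apply: lin_add; [apply: lin_mulr | apply: lin_mull].
  - by move=> u Hu; exact: tracial_pair_pos.
  - move=> U s HU.
    have := pos_conj (c - s .* 1)%A (tracial_pair_pos Se HU HV); rewrite -/(G U V).
    rewrite starB star_rsc star1.
    set g := G U V.
    have -> // : ((c^* - s .* 1) * g * (c - s .* 1))%A =
      (c^* * g * c + s .* (- (g * c + c^* * g)) + (s * s) .* g)%A.
    have -> : ((c^* - s .* 1) * g * (c - s .* 1))%A =
      (c^* * g * c - ((s .* 1 * g * c) + (c^* * g * (s .* 1))) + s .* 1 * g * (s .* 1))%A by nc.
    rewrite -(mulA _ (s .* 1)%A g c) !rsc1_mul !mul_rsc1 rscA -rscDr.
    rewrite /rsc smulN; nc.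
(* Integration over the spectrum of [k]: the result of [inner] is again a quadratic polynomial in
   [t]. *)
have outer : positive (
   (b^* * G 1 1 * b + (- (G h 1 * b + b^* * G h 1)) + G (h * h) 1)
   + Ci *: (G 1 k * b + - (b^* * G 1 k)) + G 1 (k * k))%A.
  apply: (@quadratic_pos _ _
    (fun v => b^* * G 1 v * b + (- (G h v * b + b^* * G h v)) + G (h * h) v)%A
    (fun v => Ci *: (G 1 v * b + - (b^* * G 1 v)))%A
    (fun v => G 1 v)%A) => //.
  - apply: lin_add => //; apply: lin_add; first by apply: lin_mulr; apply: lin_mull.
    by apply: lin_opp; apply: lin_add; [apply: lin_mulr | apply: lin_mull].
  - apply: lin_smul; apply: lin_add; first exact: lin_mulr.
    by apply: lin_opp; apply: lin_mull.
  - by move=> v Hv; apply: tracial_pair_pos => //; rewrite -[1%A]mul1l; exact: sa_sqr_pos sa1.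
  - move=> V t HV; have := inner V t HV; cbv zeta.
    rewrite starB star_rsc star_Ci star1.
    set g := G 1%A V; set gh := G h V; set J := (t .* (Ci *: 1))%A.
    have -> : (t .* (- (Ci *: 1)))%A = (- J)%A :> B.
      by rewrite /J -rscN oppE rscA; congr rsc; ring.
    have JC (x : B) : (x * J)%A = (J * x)%A.
      by rewrite /J -rscMr -rscMl -smulMl -smulMr mul1l mul1r.
    have JJ : (J * J)%A = (- ((t * t) .* 1))%A :> B.
      by rewrite /J -rscMl -smulMl mul1l -rsc_Ci rscA -CiCi rsc_Ci rsc_Ci.
    have JE (x : B) : (t .* (Ci *: x))%A = (J * x)%A.
      by rewrite /J -rscMl -smulMl mul1l.
    rewrite JE.
    have -> // : ((b^* - - J) * g * (b - J) + - (gh * (b - J) + (b^* - - J) * gh) + G (h * h) V)%A =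
      (b^* * g * b + - (gh * b + b^* * gh) + G (h * h) V + J * (g * b + - (b^* * g)) + (t * t) .* g)%A.
    have -> : ((t * t) .* g)%A = (- (J * J) * g)%A.
      by rewrite JJ -[g in LHS]mul1l rscMl; nc.
    have -> : ((b^* - - J) * g * (b - J) + - (gh * (b - J) + (b^* - - J) * gh) + G (h * h) V)%A =
      (b^* * g * b - (b^* * g) * J + J * g * b - J * (g * J) - gh * b + gh * J
       - b^* * gh - J * gh + G (h * h) V)%A by nc.
    rewrite !JC; nc.
set E := (_ - _ - _ + _)%A; set E' := (_ + _)%A in outer.
suff -> : E = E' by [].
have EX : Phi (e * X)%A = (G h 1 + Ci *: G 1 k)%A.
  rewrite /X mulDr (mapD Hlin) -smulMr (mapZ Hlin); congr add; last congr smul.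
    apply: (@trace_cycle e (h * e)%A); nc.
  apply: (@trace_cycle e (e * k)%A); nc.
have GS u v : self_adjoint u -> self_adjoint v -> self_adjoint (G u v).
  move=> Su Sv; rewrite /self_adjoint /G -(map_star Hlin Hpos) !starM Su Sv Se.
  apply: (@trace_cycle (e * v * e)%A u); nc.
have EXs : Phi (X^* * e)%A = (G h 1 - Ci *: G 1 k)%A.
  have -> : (X^* * e)%A = ((e * X)^* )%A by rewrite starM Se.
  rewrite (map_star Hlin Hpos) EX.
  by rewrite star_cartesian //; apply: GS => //; exact: sa1.
have EXX : Phi (X^* * X)%A = (G (h * h) 1 + G 1 (k * k))%A.
  rewrite /X starD star_Ci !starM Se Sh Sk.
  have -> : ((e * h + - (Ci *: (k * e))) * (h * e + Ci *: (e * k)))%A =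
    (e * h * h * e - Ci *: (k * e) * (Ci *: (e * k))
     + (e * h * (Ci *: (e * k)) - Ci *: (k * e) * (h * e)))%A by nc.
  rewrite -!smulMl -!smulMr CiCi (mapD Hlin) (mapB Hlin) (mapB Hlin) !(mapZ Hlin) (mapN Hlin).
  have -> : Phi (e * h * h * e)%A = G (h * h)%A 1%A.
    by apply: (@trace_cycle e (h * h * e)%A); nc.
  have -> : Phi (k * e * (e * k))%A = G 1%A (k * k)%A.
    by apply: (@trace_cycle (k * e)%A (e * k)%A); nc.
  (* Traciality cancels the two cross terms, as if [h] and [k] commuted. *)
  have -> : Phi (e * h * (e * k))%A = Phi (k * e * (h * e))%A.
    by apply: (@trace_cycle (e * h * e)%A k); nc.
  nc.
rewrite /E /E' EX EXs EXX.
have -> : Phi (e * e)%A = G 1%A 1%A by congr Phi; nc.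
rewrite smulDr smulN smulMl smulMr; nc.
Qed.

(* Solving [r X r = h e + i e k] reduces the inequality to the commuting case. *)
Lemma tracial_schwarz e X (b : B) : positive e -> invertible e ->
  positive (Phi (e * (X^* * (e * X))) - (Phi (e * e * X))^* * b - b^* * Phi (e * e * X)
            + b^* * Phi (e * e) * b)%A.
Proof.
move=> He Ie; have [r [_ [Hr Er]]] := pos_sqrt He.
have Sr := pos_sa Hr; have Se := pos_sa He.
have [h [k [Sh [Sk EX]]]] := two_sided_decomposition (r * X * r)%A He Ie.
have := two_sided_schwarz b Se Sh Sk; rewrite /= -EX.
have H1 : Phi ((r * X * r)^* * (r * X * r))%A = Phi (e * (X^* * (e * X)))%A.
  by apply: (@trace_cycle (r * X^* * r * r * X)%A r); rewrite ?starM ?Sr -?Er; nc.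
have H2 : Phi (e * (r * X * r))%A = Phi (e * e * X)%A.
  by apply: (@trace_cycle (e * r * X)%A r); rewrite -?Er; nc.
have H3 : Phi ((r * X * r)^* * e)%A = ((Phi (e * e * X))^* )%A.
  by rewrite -H2 -(map_star Hlin Hpos) (starM _ e) Se.
by rewrite H1 H2 H3.
Qed.

End CauchySchwarz.

(** Brings the nested square root back to the calculus of the single element [x], where products
    commute and values are unique. *)
Lemma pos_sqrt_fc (A : CStarAlg) (x y : A) f : self_adjoint x -> is_fcalc x f y ->
  (forall t, specR x t -> 0 <= f t) ->
  is_fcalc x (fun t => sqrt (f t)) (fcalc y sqrt) /\
  (fcalc y sqrt * fcalc y sqrt)%A = y.
Proof.
move=> Hx Hf H0; have Py := fc_pos Hx Hf H0.
have [w [Hw [_ Ew]]] := pos_sqrt Py.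
rewrite (fcalcE (pos_sa Py) Hw); split=> //.
exact: fc_comp Hf Hw.
Qed.

(** * The two inequalities for abstract weights *)

Section TracialInequalities.
Context {A B : CStarAlg}.
Variable Phi : A -> B.
Hypothesis Hlin : linear_map Phi.
Hypothesis Hpos : positive_map Phi.
Hypothesis Htr : tracial Phi.
Implicit Types (c d e X : A).

(** In the expansion of the square of [Y - Z], both cross terms reduce to the middle term [M], by
    moving one factor around the trace and commuting [c] with [d]. *)
Lemma tracial_amgm c d X : self_adjoint c -> self_adjoint d -> (c * d)%A = (d * c)%A ->
  le (Phi (c * d * (X^* * (c * d * X)))%A)
     (/ 2 .* (Phi (c * c * X^* * (d * d * X)) + Phi (c * c * X * (d * d * X^* ))))%A.
Proof.
move=> Sc Sd C; set M := Phi (c * d * _)%A.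
pose Y := (d * X * c)%A; pose Z := (c * X * d)%A.
have H := Hpos (starM_pos (Y - Z)%A).
have EYs : (Y^* )%A = (c * X^* * d)%A by rewrite /Y !starM Sc Sd; nc.
have EZs : (Z^* )%A = (d * X^* * c)%A by rewrite /Z !starM Sc Sd; nc.
have E1 : Phi (Y^* * Y)%A = Phi (c * c * X^* * (d * d * X))%A.
  by apply: (trace_cycle Htr (c * X^* * d * d * X)%A c); rewrite ?EYs /Y; nc.
have E2 : Phi (Z^* * Z)%A = Phi (c * c * X * (d * d * X^* ))%A.
  by apply: (trace_cycle Htr (d * X^* )%A (c * c * X * d)%A); rewrite ?EZs /Z; nc.
have E3 : Phi (Y^* * Z)%A = M.
  apply: (trace_cycle Htr (c * X^* * (d * c) * X)%A d).
    rewrite EYs /Z; nc.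
  rewrite -C.
  have -> : (d * (c * X^* * (c * d) * X))%A = (d * c * X^* * (c * d) * X)%A by nc.
  rewrite -C; nc.
have E4 : Phi (Z^* * Y)%A = M.
  apply: (trace_cycle Htr (d * X^* * (c * d) * X)%A c); first by rewrite EZs /Y; nc.
  nc.
have E : ((Y - Z)^* * (Y - Z))%A = (Y^* * Y + Z^* * Z - (Y^* * Z + Z^* * Y))%A.
  rewrite starB; nc.
rewrite E (mapB Hlin) !(mapD Hlin) E1 E2 E3 E4 in H.
have := @pos_rsc _ (/ 2) _ ltac:(lra) H.
by rewrite rscB rsc_half.
Qed.

(** Completing the square: [b = W * S] minimises the quadratic expression in [b], since
    [T * W = 1]. *)
Lemma tracial_schwarz_inv e X : positive e -> invertible e -> invertible (Phi (e * e)%A) ->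
  le ((Phi (e * e * X))^* * inv (Phi (e * e)) * Phi (e * e * X))%A
     (Phi (e * (X^* * (e * X))))%A.
Proof.
move=> He Ie IT; have Se := pos_sa He.
set T := Phi (e * e)%A in IT *; set S := Phi (e * e * X)%A.
have HW := invP IT; set W := inv T in HW *; have [W1 W2] := HW.
have ST : self_adjoint T by apply: (map_sa Hlin Hpos); apply: saM.
have SW := inv_sa ST HW.
have := tracial_schwarz Hlin Hpos Htr X (W * S)%A He Ie.
rewrite -/S -/T starM SW.
have -> : (S^* * W * T * (W * S))%A = (S^* * W * (T * W) * S)%A by nc.
rewrite W1 mul1r /le.
set M := Phi _.
have -> // : (M - S^* * (W * S) - S^* * W * S + S^* * W * S)%A = (M - S^* * W * S)%A by nc.
Qed.

End TracialInequalities.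

Theorem theorem5p1 (A B : CStarAlg) (Phi : A -> B)
  (Hlin : linear_map Phi) (Hpos : positive_map Phi) (Htr : tracial Phi)
  (rho : A) (Hrho : self_adjoint rho)
  (a b : R) (Hab : forall t, specR rho t -> a <= t <= b)
  (f g : R -> R)
  (Hfc : cont_on (fun t => a <= t <= b) f) (Hgc : cont_on (fun t => a <= t <= b) g)
  (Hf0 : forall t, a <= t <= b -> 0 <= f t) (Hg0 : forall t, a <= t <= b -> 0 <= g t)
  (Hfg : strictly_positive (mul A (fcalc rho f) (fcalc rho g)))
  (Hinv : invertible (Phi (mul A (fcalc rho f) (fcalc rho g)))) :
  (forall X : A,
     let F := fcalc rho f in let G := fcalc rho g in
     let Fh := fcalc F sqrt in let Gh := fcalc G sqrt in
     le (Phi (mul A (mul A Fh Gh) (mul A (star A X) (mul A (mul A Fh Gh) X))))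
        (rsc (/ 2) (add B (Phi (mul A (mul A F (star A X)) (mul A G X)))
                          (Phi (mul A (mul A F X) (mul A G (star A X)))))) /\
     le (mul B (mul B (Phi (mul A (mul A F (star A X)) G)) (inv (Phi (mul A F G))))
               (Phi (mul A (mul A G X) F)))
        (Phi (mul A (mul A Fh Gh) (mul A (star A X) (mul A (mul A Fh Gh) X))))) /\
  (forall X : A, self_adjoint X ->
     le (Iinfo rho Phi f g X)
        (Iinfo rho Phi (fun t => sqrt (f t * g t)) (fun t => sqrt (f t * g t)) X) /\
     le (Iinfo rho Phi (fun t => sqrt (f t * g t)) (fun t => sqrt (f t * g t)) X)
        (Var rho Phi (fun t => f t * g t) (fun _ => 1) X)).
Proof.
have HF := fcalcP (fc_exists Hrho Hab Hfc).
have HG := fcalcP (fc_exists Hrho Hab Hgc).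
set F := fcalc rho f in HF Hfg Hinv *; set G := fcalc rho g in HG Hfg Hinv *.
have F0 t : specR rho t -> 0 <= f t by move=> /Hab; exact: Hf0.
have G0 t : specR rho t -> 0 <= g t by move=> /Hab; exact: Hg0.
have [Hc Ec] := pos_sqrt_fc Hrho HF F0.
have [Hd Ed] := pos_sqrt_fc Hrho HG G0.
set c := fcalc F sqrt in Hc Ec *; set d := fcalc G sqrt in Hd Ed *.
have He := fc_mul Hc Hd.
have comm f1 g1 (y z : A) : is_fcalc rho f1 y -> is_fcalc rho g1 z -> (y * z)%A = (z * y)%A.
  move=> Hy Hz; apply: (fc_unique Hrho (fc_mul Hy Hz)).
  by apply: fc_ext (fc_mul Hz Hy) => t _; ring.
have Ccd := comm _ _ _ _ Hc Hd.
have CFG := comm _ _ _ _ HF HG.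
have Ee : (c * d * (c * d))%A = (F * G)%A.
  have -> : (c * d * (c * d))%A = (c * (d * c) * d)%A by nc.
  rewrite -Ccd -Ec -Ed; nc.
have Pe : positive (c * d)%A.
  by apply: (fc_pos Hrho He) => t _; apply: Rmult_le_pos; exact: sqrt_pos.
(* A factor of its own invertible square [F * G]. *)
have Ie : invertible (c * d)%A.
  by apply: (@invertible_factor _ _ (c * d)%A) => //; rewrite Ee; case: Hfg.
have Esqrt : fcalc rho (fun t => sqrt (f t * g t)) = (c * d)%A.
  apply: (fcalcE Hrho); apply: fc_ext He => t Ht.
  by rewrite sqrt_mult //; [exact: F0 | exact: G0].
have part1 (X : A) :
  le (Phi (c * d * (X^* * (c * d * X)))%A)
     (/ 2 .* (Phi (F * X^* * (G * X)) + Phi (F * X * (G * X^* ))))%A.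
  rewrite -Ec -Ed.
  exact: tracial_amgm (fc_sa Hrho Hc) (fc_sa Hrho Hd) Ccd.
have part2 (X : A) :
  le (Phi (F * X^* * G) * inv (Phi (F * G)) * Phi (G * X * F))%A
     (Phi (c * d * (X^* * (c * d * X))))%A.
  have E1 : Phi (G * X * F)%A = Phi (c * d * (c * d) * X)%A.
    by rewrite Ee; apply: (trace_cycle Htr (G * X)%A F); nc.
  have -> : Phi (F * X^* * G)%A = ((Phi (G * X * F))^* )%A.
    rewrite -(map_star Hlin Hpos) !starM (fc_sa Hrho HF) (fc_sa Hrho HG).
    by congr Phi; nc.
  rewrite E1 -Ee; apply: tracial_schwarz_inv => //.
  by rewrite Ee.
split=> [X|X HX]; first by split.
(* For self-adjoint [X] the two averaged terms coincide. Both informations and the variance subtract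
   one of the compared quantities from the common term [Phi (F * G * (X * X))], which reverses the
   order. *)
have p1 := part1 X; have p2 := part2 X.
rewrite HX rsc_half in p1; rewrite HX in p2.
rewrite /Var /Cov /Iinfo /Corr Esqrt -/F -/G HX Ee.
rewrite (fcalcE Hrho (fc_mul HF HG)) (fcalcE Hrho (fc_const rho 1)) rsc1.
rewrite !mul1r; split.
- move: p1; rewrite /le.
  have -> : Phi (c * d * (X * (c * d * X)))%A = Phi (c * d * X * (c * d * X))%A by congr Phi; nc.
  by congr positive; nc.
- move: p2; rewrite /le.
  have -> : Phi (c * d * (X * (c * d * X)))%A = Phi (c * d * X * (c * d * X))%A by congr Phi; nc.
  have -> : Phi (F * X * G)%A = Phi (F * G * X)%A.
    by rewrite CFG; apply: (trace_cycle Htr (F * X)%A G); nc.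
  have -> : Phi (G * X * F)%A = Phi (F * G * X)%A.
    by apply: (trace_cycle Htr (G * X)%A F); nc.
  by congr positive; nc.
Qed.
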